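(* Let $\Omega=(a,b)\subset\mathbb{R}$ be a bounded open interval and let $f\in BV(\Omega)$ be continuous at a point $x\in\Omega$ (i.e. $|Df|(\{x\})=0$). Let $\alpha\in C(\overline{\Omega})$ with $\alpha>0$ on $\overline\Omega$ and $\alpha'\in BV(\Omega)$ be such that $|D\alpha'|(\{x\})>0$. Let $u$ be the solution of $$\min_{u\in BV(\Omega)}\ \frac12\int_\Omega (f-u)^2\,dx+\int_\Omega \alpha(x)\,d|Du| .$$ Then the following hold. (i) If $D\alpha'(\{x\})<0$, then $|Du|((x-\epsilon,x+\epsilon))=0$ for some sufficiently small $\epsilon>0$. (ii) If $D\alpha'(\{x\})>0$, then $u$ may or may not have a jump discontinuity at $x$, and in any case $$|Du|(\{x\})\le D\alpha'(\{x\}).$$ In the particular case where there exists $\epsilon>0$ such that $(x-\epsilon,x+\epsilon)\subseteq\mathrm{supp}(|Du|)$, $u$ has a jump discontinuity at $x$ and $$|Du|(\{x\})=D\alpha'(\{x\}).$$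
   Context: For $u\in BV(\Omega)$, $Du$ denotes its distributional derivative (a finite signed Radon measure), $|Du|$ its total variation measure, and $u$ has a jump discontinuity at $x$ if $|Du|(\{x\})>0$. The condition $\alpha'\in BV(\Omega)$ means that the weak derivative $\alpha'$ of $\alpha$ is a function of bounded variation; $D\alpha'$ is the distributional derivative (a finite signed Radon measure) of $\alpha'$. The minimisation problem has a unique solution. *)

(* Defs.v *)
From HB Require Import structures.
From mathcomp Require Import all_boot all_order all_algebra.
From mathcomp Require Import all_classical all_reals all_analysis.

Set Implicit Arguments.
Unset Strict Implicit.
Unset Printing Implicit Defensive.

Import Order.TTheory GRing.Theory Num.Theory.
Import numFieldNormedType.Exports.

Local Open Scope classical_set_scope.
Local Open Scope ring_scope.

(* The library's Jordan decomposition is parameterized by a Hahn decomposition.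
   One is chosen here; by [Hahn_decomposition_uniq] the values on measurable
   sets do not depend on the choice. *)

Lemma hahn_pair_subproof d (T : measurableType d) (R : realType)
    (nu : {charge set T -> \bar R}) :
  exists PN : set T * set T, hahn_decomposition nu PN.1 PN.2.
Proof.
have [P [N nuPN]] := Hahn_decomposition nu.
by exists (P, N).
Qed.

Definition hahn_pair d (T : measurableType d) (R : realType)
    (nu : {charge set T -> \bar R}) : set T * set T :=
  sval (cid (hahn_pair_subproof nu)).

Lemma hahn_pairP d (T : measurableType d) (R : realType)
    (nu : {charge set T -> \bar R}) :
  hahn_decomposition nu (hahn_pair nu).1 (hahn_pair nu).2.
Proof. exact: (svalP (cid (hahn_pair_subproof nu))). Qed.

Definition charge_pos_variation d (T : measurableType d) (R : realType)
    (nu : {charge set T -> \bar R}) : {finite_measure set T -> \bar R} :=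
  jordan_pos (hahn_pairP nu).

Definition charge_neg_variation d (T : measurableType d) (R : realType)
    (nu : {charge set T -> \bar R}) : {finite_measure set T -> \bar R} :=
  jordan_neg (hahn_pairP nu).

Definition charge_total_variation d (T : measurableType d) (R : realType)
    (nu : {charge set T -> \bar R}) : {measure set T -> \bar R} :=
  charge_variation (hahn_pairP nu).

Definition charge_Rintegral d (T : measurableType d) (R : realType)
    (nu : {charge set T -> \bar R}) (D : set T) (g : T -> R) : R :=
  \int[charge_pos_variation nu]_(t in D) g t - \int[charge_neg_variation nu]_(t in D) g t.

Definition measure_support (R : realType)
    (mu : {measure set (measurableTypeR R) -> \bar R}) : set R :=
  [set x | forall U : set R, open U -> U x -> (0 < mu U)%E].

Definition test_function (R : realType) (a b : R) (phi : R -> R) : Prop :=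
  [/\ forall (n : nat) (t : R), derivable (derive1n n phi) t 1,
      compact (closure [set t | phi t != 0]) &
      closure [set t | phi t != 0] `<=` `]a, b[].

Definition weak_derivative (R : realType) (a b : R) (g dg : R -> R) : Prop :=
  forall phi : R -> R, test_function a b phi ->
    \int[@lebesgue_measure R]_(t in `]a, b[) (g t * derive1 phi t) =
    - \int[@lebesgue_measure R]_(t in `]a, b[) (dg t * phi t).

(* [BV_deriv a b u Du]: u belongs to BV(]a, b[) and Du is its distributional
   derivative. A finite signed measure on ]a, b[ is encoded as a charge on the
   Borel sets of R that vanishes outside ]a, b[; a charge takes finite values,
   and a finite Borel measure on R is automatically Radon. Only the values of u
   on ]a, b[ matter. *)
Definition BV_deriv (R : realType) (a b : R) (u : R -> R)
    (Du : {charge set (measurableTypeR R) -> \bar R}) : Prop :=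
  [/\ (@lebesgue_measure R).-integrable `]a, b[ (EFin \o u),
      forall A : set (measurableTypeR R), measurable A ->
        A `&` `]a, b[ = set0 -> Du A = 0%E &
      forall phi : R -> R, test_function a b phi ->
        \int[@lebesgue_measure R]_(t in `]a, b[) (u t * derive1 phi t) =
        - charge_Rintegral Du `]a, b[ phi].

Definition tv_energy (R : realType) (a b : R) (f alpha : R -> R) (u : R -> R)
    (Du : {charge set (measurableTypeR R) -> \bar R}) : \bar R :=
  ((2^-1)%:E * \int[@lebesgue_measure R]_(t in `]a, b[) ((f t - u t) ^+ 2)%:E
   + \int[charge_total_variation Du]_(t in `]a, b[) (alpha t)%:E)%E.

Definition tv_solution (R : realType) (a b : R) (f alpha : R -> R) (u : R -> R)
    (Du : {charge set (measurableTypeR R) -> \bar R}) : Prop :=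
  BV_deriv a b u Du /\
  forall (v : R -> R) (Dv : {charge set (measurableTypeR R) -> \bar R}),
    BV_deriv a b v Dv ->
    (tv_energy a b f alpha u Du <= tv_energy a b f alpha v Dv)%E.

(* [dalpha] is the weak derivative of [alpha], and [Ddalpha] is the
   distributional derivative of [dalpha]. *)
Definition tv_data (R : realType) (a b x : R) (f : R -> R)
    (Df : {charge set (measurableTypeR R) -> \bar R}) (alpha dalpha : R -> R)
    (Ddalpha : {charge set (measurableTypeR R) -> \bar R}) : Prop :=
  [/\ BV_deriv a b f Df /\ charge_total_variation Df [set x] = 0%E,
      {within `[a, b], continuous alpha},
      forall t : R, t \in `[a, b] -> 0 < alpha t,
      weak_derivative a b alpha dalpha /\ BV_deriv a b dalpha Ddalpha &
      (0 < charge_total_variation Ddalpha [set x])%E].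

(* Main.v *)
Require Import Defs.
From HB Require Import structures.
From mathcomp Require Import all_boot all_order all_algebra.
From mathcomp Require Import all_classical all_reals all_analysis.
From mathcomp Require Import measurable_realfun ring lra.

(* Put [g = f - u] and let [G p] be the integral of [g] over [p, b]. Perturbing the minimizer
   by jumps, and shrinking the positive and the negative part of [Du], gives the optimality
   conditions [|G| <= alpha], with [G = alpha] on the support of the positive part of [Du]
   and [G = - alpha] on that of the negative part. Since [alpha > 0] is continuous, near a
   point [x] of the support of [Du] only one of the two parts survives, say the positive
   one; then [alpha - G] is nonnegative and vanishes at [x]. Its derivative [dalpha + g]
   is of bounded variation, and at a minimum it can only jump upwards, so
   [Du {x} <= Ddalpha {x}] because [f] does not jump at [x]. If [alpha - G] vanishes
   identically near [x], its derivative does not jump at all and equality holds. *)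

Set Implicit Arguments.
Unset Strict Implicit.
Unset Printing Implicit Defensive.

Import Order.TTheory GRing.Theory Num.Theory.
Import numFieldNormedType.Exports.

Local Open Scope classical_set_scope.
Local Open Scope ring_scope.

(** * Smooth functions and a smooth step *)

Section smooth_functions.
Context {R : realType}.
Implicit Types (f g : R -> R) (n k : nat) (t : R).

(** The functions [f], [u] and [dalpha] matter only up to null sets, so no one-sided limit or jump
    is available at the start. Smooth approximations of indicators of intervals recover increments
    at Lebesgue points, and a BV function becomes, almost everywhere, a constant plus a difference
    of distribution functions of finite measures, whose one-sided limits and atoms are explicit.
    Distribution functions are also the directions of perturbation: if [w] is that of [k], Fubini
    turns the integral of [g * w] into the integral of [G] against [k], which is where [G] comes
    from; a Dirac mass at [p] yields [G p]. A perturbed derivative is a difference [m - n] of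
    measures that need not be mutually singular; the bound of its total variation by [m + n] is all
    that minimality requires. For (i), contact at [x] would give [0 <= |Du| {x} <= Ddalpha {x} < 0],
    so [x] lies off the contact set, which is closed. That [u] may or may not jump is shown by two
    explicit solutions; convexity makes the optimality conditions sufficient. *)

Fixpoint ndiff n f : Prop :=
  if n is m.+1 then (forall t, derivable f t 1) /\ ndiff m (derive1 f) else True.

(** [ndiff] recurses through the derivative, which lets the closure properties below go by induction
    on [n] with the functions generalized; this lemma returns to the iterated derivatives that
    [test_function] asks for. *)
Lemma ndiff_derivable f : (forall n, ndiff n f) ->
  forall n t, derivable (derive1n n f) t 1.
Proof.
move=> nf n; have {nf}: ndiff n.+1 f by [].
elim: n f => [|n IH] f [df nf] t; first exact: df.
by rewrite derive1Sn; exact: IH.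
Qed.

Lemma ndiffS n f : ndiff n.+1 f -> ndiff n f.
Proof.
elim: n f => [|n IH] f; first by [].
by case=> df nf; split; [exact: df|exact: IH].
Qed.

Lemma is_derive_derive1 f t (d : R) : is_derive t 1 f d -> derive1 f t = d.
Proof. by move=> [_ <-]; rewrite derive1E. Qed.

Lemma derivable_is_derive f t : derivable f t 1 -> is_derive t 1 f (derive1 f t).
Proof. by move=> df; rewrite derive1E; exact: derivableP. Qed.

Lemma ndiff_is_derive n f df : (forall t, is_derive t 1 f (df t)) ->
  ndiff n df -> ndiff n.+1 f.
Proof.
move=> fd ndf; split=> [t|]; first by case: (fd t).
suff -> : derive1 f = df by [].
by apply/funext => t; exact: is_derive_derive1.
Qed.

Lemma ndiff_cst n (c : R) : ndiff n (cst c).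
Proof. by elim: n c => // n IH c; apply: (ndiff_is_derive (df := cst 0)). Qed.

Lemma ndiffD n f g : ndiff n f -> ndiff n g -> ndiff n (f \+ g).
Proof.
elim: n f g => // n IH f g [df nf] [dg ng].
apply: (@ndiff_is_derive n (f \+ g) (derive1 f \+ derive1 g)); last exact: IH.
by move=> t; apply: is_deriveD; exact: derivable_is_derive.
Qed.

Lemma ndiffM n f g : ndiff n f -> ndiff n g -> ndiff n (f \* g).
Proof.
elim: n f g => // n IH f g nf ng; have [df nf'] := nf; have [dg ng'] := ng.
apply: (@ndiff_is_derive n (f \* g) ((f \* derive1 g) \+ (g \* derive1 f))).
  by move=> t; apply: is_deriveM; exact: derivable_is_derive.
by apply: ndiffD; apply: IH => //; exact: ndiffS.
Qed.

Lemma ndiff_comp n f g : ndiff n f -> ndiff n g -> ndiff n (f \o g).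
Proof.
elim: n f g => // n IH f g nf ng; have [df nf'] := nf; have [dg ng'] := ng.
apply: (@ndiff_is_derive n (f \o g) ((derive1 f \o g) \* derive1 g)).
  by move=> t; apply: is_derive1_comp; exact: derivable_is_derive.
by apply: ndiffM => //; apply: IH => //; exact: ndiffS.
Qed.

Lemma is_derive_affine (c d : R) t : is_derive t 1 (fun t => c * t + d) c.
Proof. by apply: is_derive_eq; rewrite addr0 [LHS]mulr1. Qed.

Lemma ndiff_affine n (c d : R) : ndiff n (fun t => c * t + d).
Proof.
apply: ndiffS; apply: (@ndiff_is_derive _ _ (cst c)); last exact: ndiff_cst.
by move=> t; exact: is_derive_affine.
Qed.

(* The family [t ^- k * expR (- t^-1)], extended by 0 to [t <= 0], is closed under
   derivation up to linear combinations, which makes all of its members smooth. *)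
Definition invexp k t : R := if 0 < t then t^-1 ^+ k * expR (- t^-1) else 0.

Lemma invexp_ge0 k t : 0 <= invexp k t.
Proof.
by rewrite /invexp; case: ifP => // t0; rewrite mulr_ge0 ?exprn_ge0 ?expR_ge0// invr_ge0 ltW.
Qed.

(** For [t > 0], one term of the exponential series gives [expR t^-1 >= t^-1 ^+ k.+1 / k.+1!], which
    absorbs the factor [t^-1 ^+ k] and leaves one power of [t]. *)
Lemma invexp_le k t : invexp k t <= k.+1`!%:R * `|t|.
Proof.
rewrite /invexp; case: ifPn => [t0|_]; last by rewrite mulr_ge0.
have ti0 : 0 < t^-1 by rewrite invr_gt0.
have f0 : (0 : R) < k.+1`!%:R by rewrite ltr0n fact_gt0.
rewrite gtr0_norm// expRN ler_pdivrMr ?expR_gt0//.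
have /(le_trans _) := expR_ge1Dxn k (ltW ti0).
move=> /(_ (t^-1 ^+ k.+1 / k.+1`!%:R)) /(_ _)/wrap[]; first by rewrite lerDr.
move=> H; have /(ler_wpM2l (ltW (mulr_gt0 f0 t0))) := H.
apply: le_trans; rewrite exprS le_eqVlt; apply/orP; left; apply/eqP.
by field; rewrite !gt_eqF.
Qed.

Lemma invexp_continuous0 k : {for 0, continuous (invexp k)}.
Proof.
have i0 : invexp k 0 = 0 by rewrite /invexp ltxx.
suff : invexp k z @[z --> 0] --> (0 : R) by rewrite /prop_for /continuous_at i0.
apply: (@squeeze_cvgr _ _ _ _ (cst 0) (fun t => k.+1`!%:R * `|t|)).
- by near=> t; rewrite /cst invexp_ge0 invexp_le.
- exact: cvg_cst.
- have : k.+1`!%:R * `|t| @[t --> (0 : R)] --> k.+1`!%:R * `|(0 : R)|.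
    by apply: cvgMr; apply: cvg_norm; exact: cvg_id.
  by rewrite normr0 mulr0.
Unshelve. all: by end_near. Qed.

Lemma is_derive_invexp k t :
  is_derive t 1 (invexp k) (- k%:R * invexp k.+1 t + invexp k.+2 t).
Proof.
have [t0|t0|->] := ltgtP t 0.
- have -> : - k%:R * invexp k.+1 t + invexp k.+2 t = 0.
    by rewrite /invexp ltNge (ltW t0)/= mulr0 addr0.
  apply: (@near_eq_is_derive _ _ _ (cst (0 : R)) _ t 1 0).
  have := lt_nbhsl t0; apply: filterS => s s0.
  by rewrite /invexp ltNge (ltW s0).
- pose h := fun s : R => s^-1 ^+ k * expR (- s^-1).
  apply: (@near_eq_is_derive _ _ _ h).
    have := lt_nbhsr t0; apply: filterS => s s0.
    by rewrite /invexp s0.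
  have tn0 : t != 0 by rewrite gt_eqF.
  have dV : is_derive t 1 (fun s : R => s^-1) (- t ^- 2).
    have := @is_deriveV R id t 1 1 tn0 (is_derive_id _ _).
    by rewrite [X in is_derive _ _ _ X]mulr1.
  have dX := @is_deriveX _ _ (fun s : R => s^-1) k t 1 _ dV.
  have dE : is_derive t 1 (expR \o (fun s : R => - s^-1)) (expR (- t^-1) * t ^- 2).
    apply: is_derive1_comp.
    by apply: is_derive_eq; rewrite opprK.
  have -> : h = (fun s : R => s^-1) ^+ k * (expR \o (fun s : R => - s^-1)).
    by apply/funext => s; rewrite /h exprfctE.
  apply: (is_derive_eq (is_deriveM dX dE)).
  rewrite exprfctE /invexp t0 /GRing.scale/= -!exprVn.
  case: k {h dX} => [|k].
    by rewrite !mul0r mulr0 addr0 oppr0 mul0r add0r expr0 mul1r mulrC.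
  by rewrite -mulr_natl !exprS/=; field.
(* The difference quotient of [invexp k] at 0 is [invexp k.+1] itself, which is continuous at 0 with
   value 0. *)
- apply/is_derive1_caratheodory; exists (invexp k.+1); split.
  + move=> z; rewrite /invexp ltxx !subr0; case: ifPn => z0; last by rewrite mul0r.
    by rewrite exprS; field; rewrite gt_eqF.
  + exact: invexp_continuous0.
  + by rewrite /invexp ltxx mulr0 addr0.
Qed.

Lemma ndiff_invexp n k : ndiff n (invexp k).
Proof.
elim: n k => // n IH k.
apply: (ndiff_is_derive (is_derive_invexp k)).
apply: ndiffD; last exact: IH.
apply: (@ndiffM n (cst (- k%:R)) (invexp k.+1)); [exact: ndiff_cst|exact: IH].
Qed.

Lemma invexp0_le s t : s <= t -> invexp 0 s <= invexp 0 t.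
Proof.
move=> st; rewrite {1}/invexp; case: ifPn => s0; last exact: invexp_ge0.
have t0 := lt_le_trans s0 st.
by rewrite /invexp t0 !expr0 !mul1r ler_expR lerN2 lef_pV2.
Qed.

(** The threshold in [smoothstep]: [c - invexp 0 (1 - t)] is nonpositive for [t <= 0] and equals [c]
    for [t >= 1], so dividing by [invexp 0 c] produces the values 0 and 1. *)
Let c := invexp 0 1.

Let c_gt0 : 0 < c.
Proof. by rewrite /c /invexp ltr01 mul1r expR_gt0. Qed.

(* Built by composing the smooth function [invexp 0], so that only closure of smooth
   functions under composition is needed, not under quotients. *)
Definition smoothstep t : R := invexp 0 (c - invexp 0 (1 - t)) / invexp 0 c.

Let d_gt0 : 0 < invexp 0 c.
Proof. by rewrite /invexp c_gt0 mul1r expR_gt0. Qed.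

Lemma ndiff_smoothstep n : ndiff n smoothstep.
Proof.
have -> : smoothstep = (invexp 0 \o (fun s => (-1) * s + c) \o invexp 0 \o
    (fun s => (-1) * s + 1)) \* cst (invexp 0 c)^-1.
  by apply/funext => t; rewrite /smoothstep/= !mulN1r ![- _ + _]addrC.
apply: ndiffM; last exact: ndiff_cst.
repeat apply: ndiff_comp; try exact: ndiff_invexp; exact: ndiff_affine.
Qed.

Lemma smoothstep_ge0 t : 0 <= smoothstep t.
Proof. by rewrite divr_ge0// invexp_ge0. Qed.

Lemma smoothstep_le1 t : smoothstep t <= 1.
Proof.
rewrite ler_pdivrMr// mul1r; apply: invexp0_le.
by rewrite lerBlDr lerDl invexp_ge0.
Qed.

Lemma smoothstep0 t : t <= 0 -> smoothstep t = 0.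
Proof.
move=> t0; rewrite /smoothstep [X in X / _](_ : _ = 0) ?mul0r//.
by rewrite /invexp ltNge subr_le0 invexp0_le//= lerBrDl gerDr.
Qed.

Lemma smoothstep1 t : 1 <= t -> smoothstep t = 1.
Proof.
move=> t1; rewrite /smoothstep [invexp 0 (1 - t)](_ : _ = 0); last first.
  by rewrite /invexp ltNge subr_le0 t1.
by rewrite subr0 divff// gt_eqF.
Qed.

End smooth_functions.

(** * Calculus of test functions *)

Section calculus.
Context {R : realType}.
Notation mu := (@lebesgue_measure R).
Implicit Types (F : R -> R) (a b t : R).

Lemma continuous_integrable_itv F a b (bl br : bool) : continuous F ->
  mu.-integrable [set` Interval (BSide bl a) (BSide br b)] (EFin \o F).
Proof.
move=> cF; apply: (@integrableS _ _ _ mu `[a, b]) => //.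
  by apply: subset_itv; rewrite bnd_simp; case: bl; case: br.
by apply: continuous_compact_integrable; [exact: segment_compact|exact: continuous_subspaceT].
Qed.

Lemma Rintegral_derive F (F' : R -> R) a b (bl br : bool) : a <= b ->
  (forall t : R, is_derive t (1 : R) F (F' t)) -> continuous F' ->
  \int[mu]_(t in [set` Interval (BSide bl a) (BSide br b)]) F' t = F b - F a.
Proof.
move=> leab dF cF.
have cF0 : continuous F.
  by move=> t; apply: differentiable_continuous; apply/derivable1_diffP; case: (dF t).
have mF (D : set R) : measurable_fun D (fun t => (F' t)%:E).
  by apply/measurable_EFinP; apply: measurable_funTS; exact: continuous_measurable_fun.
have -> : \int[mu]_(t in [set` Interval (BSide bl a) (BSide br b)]) F' t =
    \int[mu]_(t in `[a, b]) F' t.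
  rewrite /Rintegral; congr fine; case: bl; case: br => //.
  - exact: integral_itv_bndo_bndc.
  - by rewrite integral_itv_obnd_cbnd//; exact: integral_itv_bndo_bndc.
  - exact: integral_itv_obnd_cbnd.
move: leab; rewrite le_eqVlt => /predU1P[->|ltab].
  by rewrite set_itv1 Rintegral_set1 subrr.
rewrite /Rintegral (@continuous_FTC2 _ _ F _ _ ltab)//.
- exact: continuous_subspaceT.
- split=> //.
  + by apply: cvg_at_right_filter; exact: cF0.
  + by apply: cvg_at_left_filter; exact: cF0.
- by move=> t _; exact: is_derive_derive1.
Qed.

Lemma test_functionW a b c d F : (forall n, ndiff n F) -> a < c -> d < b ->
  (forall t, t < c \/ d < t -> F t = 0) -> test_function a b F.
Proof.
move=> nF ac db F0.
have clF : closure [set t | F t != 0] `<=` `[c, d].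
  rewrite (_ : [set` `[c, d]] = closure `[c, d]); last by apply/closure_id; exact: itv_closed.
  apply: closureS => t /= /eqP Ft; rewrite in_itv/=.
  by apply/andP; split; rewrite leNgt; apply/negP => h; apply: Ft; apply: F0; [left|right].
split.
- exact: ndiff_derivable.
- by apply: (subclosed_compact _ (@segment_compact _ c d) clF); exact: closed_closure.
- apply: (subset_trans clF) => t /=; rewrite !in_itv/= => /andP[ct td].
  by rewrite (lt_le_trans ac ct) (le_lt_trans td db).
Qed.

Lemma test_function_derivable a b F : test_function a b F -> forall t, derivable F t 1.
Proof. by move=> [dF _ _]; exact: (dF 0%N). Qed.

Lemma test_function_continuous a b F : test_function a b F -> continuous F.
Proof.
move=> tF t; apply: differentiable_continuous; apply/derivable1_diffP.
exact: test_function_derivable tF t.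
Qed.

Lemma test_function_derive1_continuous a b F :
  test_function a b F -> continuous (derive1 F).
Proof.
move=> [dF _ _] t; apply: differentiable_continuous; apply/derivable1_diffP.
exact: (dF 1%N).
Qed.

Lemma test_function_out a b F t : test_function a b F -> t \notin `]a, b[ -> F t = 0.
Proof.
move=> [_ _ sF] /negP abt; apply/eqP/negP => /negP Ft; apply: abt; apply: sF.
exact: subset_closure.
Qed.

Lemma continuous_bounded_itv F a b : {within `[a, b], continuous F} ->
  exists M, forall t, a <= t <= b -> `|F t| <= M.
Proof.
move=> cF; have [leab|ltba] := leP a b; last first.
  exists 0 => t /andP[at_ tb]; exfalso.
  by have := lt_le_trans ltba (le_trans at_ tb); rewrite ltxx.
have := @EVT_max R (fun t => `|F t|) a b leab.
case; last by move=> c _ H; exists `|F c| => t tab; apply: H; rewrite in_itv.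
move=> t; apply: continuous_comp; [exact: cF|exact: norm_continuous].
Qed.

Lemma test_function_bounded a b F : test_function a b F -> exists M, forall t, `|F t| <= M.
Proof.
move=> tF; have [M FM] := @continuous_bounded_itv F a b
  (continuous_subspaceT (test_function_continuous tF)).
exists (Num.max M 0) => t; have [abt|abt] := boolP (t \in `]a, b[).
  rewrite le_max FM//; move: abt; rewrite in_itv/= => /andP[at_ tb].
  by rewrite (ltW at_) (ltW tb).
by rewrite (test_function_out tF abt) normr0 le_max lexx orbT.
Qed.

End calculus.

(** * Smooth approximations of indicators of intervals *)

Section windows.
Context {R : realType}.
Notation mu := (@lebesgue_measure R).
Implicit Types (h p q t : R).

(** A one-sided approximate identity: it lives on [[p, p + h]], has integral 1 and is of order
    [h^-1]. *)
Definition kernel h p t : R := derive1 smoothstep (h^-1 * t + - (h^-1 * p)) * h^-1.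

Definition ramp h p t : R := smoothstep (h^-1 * t + - (h^-1 * p)).

(** As [h] tends to 0 from the right, this tends to the indicator of []p, q]], while its derivative
    is a difference of approximate identities at [p] and [q]. Testing a distributional derivative
    against it therefore relates an increment of the function to the mass of []p, q]]. *)
Definition window h p q t : R := ramp h p t - ramp h q t.

Lemma ndiff_ramp h p n : ndiff n (ramp h p).
Proof.
apply: (@ndiff_comp _ n smoothstep (fun t => h^-1 * t + - (h^-1 * p))).
  exact: ndiff_smoothstep.
exact: ndiff_affine.
Qed.

Lemma is_derive_ramp h p t : is_derive t 1 (ramp h p) (kernel h p t).
Proof.
apply: (@is_derive1_comp _ smoothstep (fun t => h^-1 * t + - (h^-1 * p))).
  by apply: derivable_is_derive; have [] := @ndiff_smoothstep R 1.
exact: is_derive_affine.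
Qed.

Lemma derive1_ramp h p : derive1 (ramp h p) = kernel h p.
Proof. by apply/funext => t; apply: is_derive_derive1; exact: is_derive_ramp. Qed.

Lemma kernel_continuous h p : continuous (kernel h p).
Proof.
rewrite -derive1_ramp => t; apply: differentiable_continuous; apply/derivable1_diffP.
by have [_ []] := @ndiff_ramp h p 2.
Qed.

Lemma ramp0 h p t : 0 < h -> t <= p -> ramp h p t = 0.
Proof.
by move=> h0 tp; rewrite /ramp smoothstep0// -mulrBr pmulr_rle0 ?invr_gt0// subr_le0.
Qed.

Lemma ramp1 h p t : 0 < h -> p + h <= t -> ramp h p t = 1.
Proof.
move=> h0 tp; rewrite /ramp smoothstep1// -mulrBr mulrC ler_pdivlMr// mul1r.
by rewrite lerBrDr addrC.
Qed.

Lemma kernel0 h p t : 0 < h -> t < p \/ p + h < t -> kernel h p t = 0.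
Proof.
move=> h0 tp; rewrite -derive1_ramp.
case: tp => tp; apply: is_derive_derive1.
- apply: (@near_eq_is_derive _ _ _ (cst (0 : R)) _ t 1 0).
  by have := lt_nbhsl tp; apply: filterS => s sp; rewrite ramp0// ltW.
- apply: (@near_eq_is_derive _ _ _ (cst (1 : R)) _ t 1 0).
  by have := lt_nbhsr tp; apply: filterS => s sp; rewrite ramp1// ltW.
Qed.

Lemma smoothstep_derive_bounded : exists2 C : R, 0 < C &
  forall t, `|derive1 smoothstep t| <= C.
Proof.
have cS : continuous (derive1 (@smoothstep R)).
  move=> t; apply: differentiable_continuous; apply/derivable1_diffP.
  by have [_ []] := @ndiff_smoothstep R 2.
have [M HM] := @continuous_bounded_itv _ _ 0 1 (continuous_subspaceT cS).
exists (Num.max M 1); first by rewrite lt_max ltr01 orbT.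
move=> t; have [t01|t01] := boolP (0 <= t <= 1); first by rewrite le_max HM.
have /(@kernel0 1 0 t ltr01) : t < 0 \/ 0 + 1 < t.
  by move: t01; rewrite negb_and -!ltNge add0r => /orP[]; [left|right].
rewrite /kernel !invr1 mulr1 mul1r mulr0 oppr0 addr0 => ->.
by rewrite normr0 le_max ler01 orbT.
Qed.

Lemma Rintegral_kernel h p a b : 0 < h -> a <= p -> p + h <= b ->
  \int[mu]_(t in `]a, b[) kernel h p t = 1.
Proof.
move=> h0 ap pb; have ph : p <= p + h by rewrite lerDl ltW.
have leab : a <= b by rewrite (le_trans ap)// (le_trans ph).
rewrite (Rintegral_derive false true leab (is_derive_ramp h p) (@kernel_continuous h p)).
by rewrite ramp1// ramp0// subr0.
Qed.

Lemma derive1_window h p q t : derive1 (window h p q) t = kernel h p t - kernel h q t.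
Proof. by apply: is_derive_derive1; apply: is_deriveB; exact: is_derive_ramp. Qed.

Lemma window_continuous h p q : continuous (window h p q).
Proof.
move=> t; apply: differentiable_continuous; apply/derivable1_diffP.
have : is_derive t 1 (window h p q) (kernel h p t - kernel h q t).
  by apply: is_deriveB; exact: is_derive_ramp.
by case.
Qed.

Lemma window_test_function a b h p q : 0 < h -> a < p -> p <= q -> q + h < b ->
  test_function a b (window h p q).
Proof.
move=> h0 ap pq qb; apply: (@test_functionW _ a b p (q + h)) => //.
  move=> n; rewrite (_ : window h p q = ramp h p \+ (cst (-1) \* ramp h q)).
    apply: ndiffD; first exact: ndiff_ramp.
    by apply: ndiffM; [exact: ndiff_cst|exact: ndiff_ramp].
  by apply/funext => t; rewrite /window /= mulN1r.
move=> t [tp|tq]; rewrite /window.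
  by rewrite !ramp0 ?subrr ?(ltW tp)// (le_trans (ltW tp)).
by rewrite !ramp1 ?subrr ?(ltW tq)// (le_trans _ (ltW tq))// lerD2r.
Qed.

Lemma window_le1 h p q t : `|window h p q t| <= 1.
Proof.
rewrite ler_norml /window /ramp lerBrDr lerBlDr.
have := @smoothstep_ge0 R (h^-1 * t + - (h^-1 * p)).
have := @smoothstep_le1 R (h^-1 * t + - (h^-1 * p)).
have := @smoothstep_ge0 R (h^-1 * t + - (h^-1 * q)).
have := @smoothstep_le1 R (h^-1 * t + - (h^-1 * q)).
move: (smoothstep _) (smoothstep _) => v w; lra.
Qed.

Lemma ramp_cvg p t : ramp h p t @[h --> 0^'+] --> (\1_`]p, +oo[ t : R).
Proof.
have [tp|pt] := leP t p.
  rewrite indicE memNset/=; last by rewrite in_itv/= andbT ltNge tp.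
  apply: cvg_near_cst; near=> h.
  by rewrite ramp0//.
rewrite indicE mem_set/=; last by rewrite in_itv/= andbT.
apply: cvg_near_cst; near=> h.
rewrite ramp1// -lerBrDl; near: h; apply: nbhs_right_ltW; by rewrite subr_gt0.
Unshelve. all: by end_near. Qed.

Lemma window_cvg p q t : p <= q ->
  window h p q t @[h --> 0^'+] --> (\1_`]p, q] t : R).
Proof.
move=> pq; have -> : \1_`]p, q] t = \1_`]p, +oo[ t - \1_`]q, +oo[ t :> R.
  rewrite !indicE !mem_setE !in_itv/= !andbT.
  have [tp|tp] := leP t p; have [tq|tq] := leP t q; rewrite ?subrr ?subr0//.
  by have := lt_le_trans tq (le_trans tp pq); rewrite ltxx.
by apply: cvgB; exact: ramp_cvg.
Qed.

End windows.

(** * Recovering increments at Lebesgue points *)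

Section lebesgue_points.
Context {R : realType}.
Notation mu := (@lebesgue_measure R).
Implicit Types (h p q t : R).

(** Since the kernel has integral 1, the left side is the integral of [(u t - u p) * kernel h p t].
    The kernel is bounded by [C / h] and vanishes outside [[p, p + h]], which the open ball of
    radius [2 * h] contains; that ball has length [4 * h], whence the constant [4 * C]. *)
Lemma kernel_davg_le (a b p : R) (u : R -> R) : p \in `]a, b[ ->
  mu.-integrable `]a, b[ (EFin \o u) ->
  exists2 C : R, 0 < C & forall h, 0 < h -> a < p - 2 * h -> p + 2 * h < b ->
  (`| \int[mu]_(t in `]a, b[) (u t * kernel h p t) - u p |%:E <=
   C%:E * davg (u \_ `]a, b[) p (2 * h))%E.
Proof.
move=> pab iu; have [C C0 HC] := @smoothstep_derive_bounded R.
exists (4 * C); first by rewrite mulr_gt0.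
move=> h h0 ah hb.
have mk (D : set R) : measurable_fun D (kernel h p).
  by apply: measurable_funTS; apply: continuous_measurable_fun; exact: kernel_continuous.
have kb t : `|kernel h p t| <= C / h.
  by rewrite /kernel normrM (gtr0_norm (_ : 0 < h^-1)) ?invr_gt0// ler_pM2r ?invr_gt0.
have bk (D : set R) : [bounded kernel h p t | t in D].
  by exists (C / h); split; [exact: num_real|move=> M /ltW CM t _ /=; exact: le_trans (kb t) CM].
have ik : mu.-integrable `]a, b[ (EFin \o kernel h p).
  by apply: continuous_integrable_itv; exact: kernel_continuous.
have iuk : mu.-integrable `]a, b[ (EFin \o (fun t => u t * kernel h p t)).
  rewrite (_ : EFin \o _ = (EFin \o u) \* (EFin \o kernel h p))%E//.
  exact: (integrableMl _ iu (mk _) (bk _)).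
have iupk : mu.-integrable `]a, b[ (EFin \o (fun t => u p * kernel h p t)).
  by rewrite (_ : EFin \o _ = (fun t => (u p)%:E * (kernel h p t)%:E)%E)//;
    apply: (integrableZl _ _ ik).
have -> : \int[mu]_(t in `]a, b[) (u t * kernel h p t) - u p =
    \int[mu]_(t in `]a, b[) (u t * kernel h p t - u p * kernel h p t).
  rewrite RintegralB// RintegralZl// Rintegral_kernel ?mulr1//.
    by rewrite (ltW (lt_trans ah _))// gtrBl mulr_gt0.
  by rewrite (le_trans _ (ltW hb))// lerD2l ler_peMl ?ltW// ltr1n.
have iub : mu.-integrable `]a, b[ (fun t => (u t * kernel h p t - u p * kernel h p t)%:E).
  exact: (integrableB _ iuk iupk).
rewrite -abse_EFin /Rintegral fineK; last exact: integrable_fin_num.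
apply: (le_trans (le_abse_integral _ _ _)) => //; first exact: measurable_int iub.
rewrite /davg /iavg lebesgue_measure_ball ?mulr_ge0 ?(ltW h0)//.
rewrite inver mulrn_eq0/= mulf_eq0 (gt_eqF h0) pnatr_eq0/=.
have mU : measurable_fun [set: R] (u \_ `]a, b[).
  by apply/(measurable_restrictT _ _).1 => //; apply/measurable_EFinP; exact: measurable_int iu.
pose U := u \_ `]a, b[.
have mUp (D : set R) : measurable_fun D (fun t => (`|U t - U p|)%:E).
  apply/measurable_EFinP; apply: measurableT_comp => //; apply: measurable_funTS.
  exact: measurable_funB.
have Up : U p = u p by rewrite /U patchE mem_set.
have -> : ((4 * C)%:E * ((2 * h *+ 2)^-1%:E *
     \int[mu]_(y in ball p (2 * h)) `|((center (U p) \o U) y)%:E|) =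
   \int[mu]_(y in ball p (2 * h)) ((C / h)%:E * (`|U y - U p|)%:E))%E.
  rewrite (ge0_integralZl mu (measurable_ball p (2 * h)) (mUp _))//; last first.
    by rewrite lee_fin divr_ge0 ?ltW.
  rewrite muleA -EFinM; congr (_%:E * _)%E.
  by rewrite mulr2n; field; rewrite gt_eqF//=; lra.
rewrite integral_mkcond [leRHS]integral_mkcond; apply: ge0_le_integral => //.
- by move=> t _; rewrite patchE; case: ifP.
- apply/(measurable_restrictT _ _).1 => //.
  apply/measurable_EFinP; apply: measurableT_comp => //.
  by apply/measurable_EFinP; exact: measurable_int iub.
- apply/(measurable_restrictT _ _).1; first exact: measurable_ball.
  by apply: emeasurable_funM => //; exact: mUp.
move=> t _; rewrite !patchE; case: ifPn => [tab|]; last first.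
  by case: ifP => // _ _; rewrite mule_ge0// lee_fin divr_ge0 ?ltW.
have Ut : U t = u t by rewrite /U patchE tab.
rewrite Ut Up -mulrBl normrM; case: ifPn => [_|tb].
  by rewrite -EFinM lee_fin mulrC ler_wpM2r.
rewrite kernel0 ?normr0 ?mulr0//.
move: tb; rewrite notin_setE ball_itv/= in_itv/= => /negP.
rewrite negb_and -!leNgt => /orP[tb|tb]; [left|right].
  by rewrite (le_lt_trans tb)// gtrBl mulr_gt0.
by rewrite (lt_le_trans _ tb)// ltrD2l ltr_pMl// ltr1n.
Qed.

Lemma cvg_integral_kernel (a b p : R) (u : R -> R) : p \in `]a, b[ ->
  mu.-integrable `]a, b[ (EFin \o u) -> lebesgue_pt (u \_ `]a, b[) p ->
  \int[mu]_(t in `]a, b[) (u t * kernel h p t) @[h --> 0^'+] --> u p.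
Proof.
move=> pab iu up; have [C C0 HC] := kernel_davg_le pab iu.
have h2 : (2 * h : R) @[h --> 0^'+] --> (0 : R)^'+.
  move=> P [e /= e0 He]; exists (e / 2); first by rewrite /= divr_gt0.
  move=> h /= he h0; apply: He; last by rewrite mulr_gt0.
  move: he; rewrite /ball_ /= !sub0r !normrN (gtr0_norm h0) gtr0_norm ?mulr_gt0//.
  by rewrite ltr_pdivlMr// mulrC.
have /fine_cvgP[fd cd] := cvg_comp _ _ h2 up.
apply/cvgrPdist_le => e e0.
move/cvgrPdist_le : cd => /(_ (e / C)); rewrite divr_gt0// => /(_ isT) cd.
move: pab; rewrite in_itv/= => /andP[ap pb].
near=> h.
have h0 : 0 < h by [].
rewrite -lee_fin distrC; apply: (le_trans (HC h h0 _ _)).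
- rewrite ltrBrDl -ltrBrDr -ltr_pdivlMl//; near: h; apply: nbhs_right_lt.
  by rewrite mulr_gt0// subr_gt0.
- rewrite -ltrBrDl -ltr_pdivlMl//; near: h; apply: nbhs_right_lt.
  by rewrite mulr_gt0// subr_gt0.
have dfin : davg (u \_ `]a, b[) p (2 * h) \is a fin_num by near: h; exact: fd.
rewrite -(fineK dfin) -EFinM lee_fin mulrC -ler_pdivlMr//.
have : `|0 - fine (davg (u \_ `]a, b[) p (2 * h))| <= e / C by near: h; exact: cd.
by rewrite sub0r normrN; apply: le_trans; exact: ler_norm.
Unshelve. all: by end_near. Qed.

Lemma cvg_integral_window (a b p q : R) (u : R -> R) : p \in `]a, b[ -> q \in `]a, b[ ->
  mu.-integrable `]a, b[ (EFin \o u) ->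
  lebesgue_pt (u \_ `]a, b[) p -> lebesgue_pt (u \_ `]a, b[) q ->
  \int[mu]_(t in `]a, b[) (u t * derive1 (window h p q) t) @[h --> 0^'+] --> u p - u q.
Proof.
move=> pab qab iu lp lq.
have iuk r h : 0 < h -> mu.-integrable `]a, b[ (EFin \o (fun t => u t * kernel h r t)).
  move=> h0; rewrite (_ : EFin \o _ = (EFin \o u) \* (EFin \o kernel h r))%E//.
  apply: (integrableMl _ iu) => //.
    by apply: measurable_funTS; apply: continuous_measurable_fun; exact: kernel_continuous.
  have [C C0 HC] := @smoothstep_derive_bounded R.
  exists (C / h); split; first exact: num_real.
  move=> M /ltW CM t _ /=; apply: le_trans CM.
  by rewrite /kernel normrM (gtr0_norm (_ : 0 < h^-1)) ?invr_gt0// ler_pM2r ?invr_gt0.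
have cB : (\int[mu]_(t in `]a, b[) (u t * kernel h p t) -
    \int[mu]_(t in `]a, b[) (u t * kernel h q t)) @[h --> 0^'+] --> u p - u q.
  by apply: cvgB; exact: cvg_integral_kernel.
move: cB; apply: cvg_trans; apply: near_eq_cvg; near=> h.
rewrite -RintegralB//; [|exact: iuk..].
by apply: eq_Rintegral => t _; rewrite derive1_window mulrBr.
Unshelve. all: by end_near. Qed.

End lebesgue_points.

(** * BV functions as distribution functions up to a constant *)

Section representation.
Context {R : realType}.
Notation mu := (@lebesgue_measure R).
Implicit Types (a b h p q t : R).
Implicit Types m : {finite_measure set (measurableTypeR R) -> \bar R}.

(** Windows are bounded by 1, so [g] itself dominates. The measure is arbitrary because this serves
    both the parts of a derivative and, with Lebesgue measure, the weak derivative of [alpha]. *)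
Lemma window_dominated_cvg (m : {measure set (measurableTypeR R) -> \bar R})
    a b p q (g : R -> R) : p <= q -> a < p -> q < b -> m.-integrable `]a, b[ (EFin \o g) ->
  \int[m]_(t in `]a, b[) (g t * window h p q t) @[h --> 0^'+] -->
  \int[m]_(t in `]p, q]) g t.
Proof.
move=> pq ap qb ig; apply/cvg_at_rightP => h [h0 hcvg].
have mg : measurable_fun `]a, b[ g by apply/measurable_EFinP; exact: measurable_int ig.
have mw n : measurable_fun `]a, b[ (fun t => (g t * window (h n) p q t)%:E).
  apply/measurable_EFinP; apply: measurable_funM => //.
  apply: measurable_funTS; apply: continuous_measurable_fun.
  exact: window_continuous.
have mi : measurable_fun `]a, b[ (fun t => (g t * \1_`]p, q] t)%:E).
  by apply/measurable_EFinP; apply: measurable_funM.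
have [|||i1 _ H] := @dominated_convergence _ _ _ m `]a, b[ (measurable_itv _)
  (fun n t => (g t * window (h n) p q t)%:E) (fun t => (g t * \1_`]p, q] t)%:E)
  (abse \o (EFin \o g)) mw mi.
- apply: aeW => t _; apply: cvg_EFin; first exact: nearW.
  apply: cvgMr; have /cvg_at_rightP := @window_cvg _ p q t pq.
  exact.
- exact: integrable_abse.
- apply: aeW => t n _; rewrite abse_EFin lee_fin normrM ler_piMr//; exact: window_le1.
rewrite [X in _ --> X](_ : _ = \int[m]_(t in `]a, b[) (g t * \1_`]p, q] t)).
  apply: fine_cvg; rewrite fineK//; exact: integrable_fin_num.
rewrite Rintegral_mkcond [RHS]Rintegral_mkcond; apply: eq_Rintegral => t _.
rewrite !patchE indicE; have [tpq|tpq] := boolP (t \in [set` `]p, q]]).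
  rewrite mem_set ?mulr1//=; move/set_mem : tpq => /=; rewrite !in_itv/= => /andP[pt tq].
  by rewrite (lt_trans ap pt) (le_lt_trans tq qb).
by rewrite mulr0; case: ifP.
Qed.

(* [m1] and [m2] need not be mutually singular: perturbing a derivative keeps it in this
   form without recomputing its Jordan decomposition. *)
Definition deriv_pair a b (u : R -> R) m1 m2 :=
  forall phi, test_function a b phi ->
    \int[mu]_(t in `]a, b[) (u t * derive1 phi t) =
    - (\int[m1]_(t in `]a, b[) phi t - \int[m2]_(t in `]a, b[) phi t).

(** The right-continuous distribution function; on []a, b[] its distributional derivative is [m], so
    it is also the primitive used as a direction of perturbation. *)
Definition mass m a t := fine (m `]a, t]%classic).

Lemma massB m a p q : a <= p -> p <= q -> mass m a q - mass m a p = fine (m `]p, q]%classic).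
Proof.
move=> ap pq; rewrite /mass.
have -> : `]a, q]%classic = `]a, p] `|` `]p, q] :> set R by rewrite -itv_bndbnd_setU ?bnd_simp.
rewrite measureU//; last first.
  rewrite -subset0 => t [] /=; rewrite !in_itv/= => /andP[_ tp] /andP[pt _].
  by have := lt_le_trans pt tp; rewrite ltxx.
by rewrite fineD ?fin_num_measure// addrC addKr.
Qed.

(** Windows are put into the defining identity: the side of [u] converges because [p] and [q] are
    Lebesgue points, the side of the measures by dominated convergence, and the two limits agree. *)
Lemma deriv_pair_lebesgue_pt a b u m1 m2 p q : deriv_pair a b u m1 m2 ->
  mu.-integrable `]a, b[ (EFin \o u) -> p <= q -> a < p -> q < b ->
  lebesgue_pt (u \_ `]a, b[) p -> lebesgue_pt (u \_ `]a, b[) q ->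
  u q - u p = fine (m1 `]p, q]%classic) - fine (m2 `]p, q]%classic).
Proof.
move=> dp iu pq ap qb lp lq.
have pab : p \in `]a, b[ by rewrite in_itv/= ap (le_lt_trans pq qb).
have qab : q \in `]a, b[ by rewrite in_itv/= qb (lt_le_trans ap pq).
have H1 := cvg_integral_window pab qab iu lp lq.
have H2 m : \int[m]_(t in `]a, b[) window h p q t @[h --> 0^'+] --> fine (m `]p, q]%classic).
  have := @window_dominated_cvg m a b p q (cst 1) pq ap qb.
  rewrite Rintegral_cst// mul1r => H.
  apply: cvg_trans (H _).
    by apply: near_eq_cvg; near=> h; apply: eq_Rintegral => t _; rewrite mul1r.
  by apply: finite_measure_integrable_cst.
have H3 : - (\int[m1]_(t in `]a, b[) window h p q t - \int[m2]_(t in `]a, b[) window h p q t)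
    @[h --> 0^'+] --> u p - u q.
  move: H1; apply: cvg_trans; apply: near_eq_cvg; near=> h.
  rewrite dp//; apply: window_test_function => //.
  by rewrite -ltrBrDl; near: h; apply: nbhs_right_lt; rewrite subr_gt0.
have H4 : - (\int[m1]_(t in `]a, b[) window h p q t - \int[m2]_(t in `]a, b[) window h p q t)
    @[h --> 0^'+] --> - (fine (m1 `]p, q]%classic) - fine (m2 `]p, q]%classic)).
  by apply: cvgN; apply: cvgB; exact: H2.
have E : u p - u q = - (fine (m1 `]p, q]%classic) - fine (m2 `]p, q]%classic)).
  exact: cvg_unique H3 H4.
lra.
Unshelve. all: by end_near. Qed.

Lemma ae_lebesgue_pt a b (u : R -> R) : mu.-integrable `]a, b[ (EFin \o u) ->
  {ae mu, forall t, lebesgue_pt (u \_ `]a, b[) t}.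
Proof. by move=> iu; apply: lebesgue_differentiation; exact: integrable_locally. Qed.

Lemma ae_itv_ex a b (P : R -> Prop) : a < b -> {ae mu, forall t, P t} ->
  exists2 t, t \in `]a, b[ & P t.
Proof.
move=> ab [N [mN N0 PN]]; apply: contrapT => H.
have : (mu `]a, b[%classic <= mu N)%E.
  apply: le_measure; rewrite ?inE//.
  by move=> t tab; apply: PN => Pt; apply: H; exists t.
by rewrite N0 lebesgue_measure_itv/= lte_fin ab -EFinD lee_fin leNgt subr_gt0 ab.
Qed.

(** Almost every point is a Lebesgue point. The constant is read off at one of them, [p], and the
    increments from [p] give the value at all the others. *)
Lemma deriv_pair_ae a b u m1 m2 : a < b -> deriv_pair a b u m1 m2 ->
  mu.-integrable `]a, b[ (EFin \o u) ->
  exists c, {ae mu, forall t, t \in `]a, b[ -> u t = c + (mass m1 a t - mass m2 a t)}.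
Proof.
move=> ab dp iu; have aelp := ae_lebesgue_pt iu.
have [p] := ae_itv_ex ab aelp; rewrite in_itv/= => /andP[ap pb] lp.
exists (u p - (mass m1 a p - mass m2 a p)).
apply: (@filterS _ _ (ae_filter_ringOfSetsType mu) _ _ _ aelp) => t lt.
rewrite in_itv/= => /andP[at_ tb].
have [pt|tp] := leP p t.
  have := deriv_pair_lebesgue_pt dp iu pt ap tb lp lt.
  rewrite -!(massB _ (ltW ap) pt); lra.
have := deriv_pair_lebesgue_pt dp iu (ltW tp) at_ pb lt lp.
rewrite -!(massB _ (ltW at_) (ltW tp)); lra.
Qed.

End representation.

(** * Distribution functions of measures *)

Section integral_of_mass.
Context {R : realType}.
Notation mu := (@lebesgue_measure R).
Implicit Types (a b p q s t : R).
Implicit Types m : {finite_measure set (measurableTypeR R) -> \bar R}.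

Definition tail_integral b (g : R -> R) s : R := \int[mu]_(t in `[s, b[) g t.

Lemma mass_ge0 m a t : 0 <= mass m a t.
Proof. exact: fine_ge0. Qed.

Lemma mass_le m a t : mass m a t <= fine (m setT).
Proof.
by rewrite fine_le ?fin_num_measure// le_measure ?inE.
Qed.

Lemma mass_homo m a s t : s <= t -> mass m a s <= mass m a t.
Proof.
move=> st; rewrite fine_le ?fin_num_measure// le_measure ?inE//.
by apply: subset_itvl; rewrite bnd_simp.
Qed.

Lemma measurable_mass m a (D : set R) : measurable_fun D (mass m a).
Proof.
apply: measurable_funTS; apply: nondecreasing_measurable => // s t; exact: mass_homo.
Qed.

Lemma bounded_mass m a (D : set R) : [bounded mass m a t | t in D].
Proof.
exists (fine (m setT)); split; first exact: num_real.
move=> M /ltW mM t _ /=; rewrite ger0_norm ?mass_ge0//.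
exact: le_trans (mass_le m a t) mM.
Qed.

Lemma fubini_set_measurable a :
  measurable [set z : measurableTypeR R * measurableTypeR R | a < z.2 <= z.1].
Proof.
have -> : [set z : measurableTypeR R * measurableTypeR R | a < z.2 <= z.1] =
    (snd @^-1` `]a, +oo[) `&` ((fun z => z.1 - z.2) @^-1` `[0, +oo[).
  apply/seteqP; split=> z /=; rewrite !in_itv/= !andbT subr_ge0; first by case/andP.
  by case=> -> ->.
apply: measurableI.
  by rewrite -[X in measurable X]setTI; exact: measurable_snd.
rewrite -[X in measurable X]setTI.
have : measurable_fun [set: measurableTypeR R * measurableTypeR R]
    (fun z => z.1 - z.2 : measurableTypeR R).
  by apply: measurable_funB; [exact: measurable_fst|exact: measurable_snd].
by move=> H; apply: H.
Qed.

(** Fubini for [g t] on the set [a < s <= t]: integrating in [s] first yields [mass m a t],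
    integrating in [t] first yields the tail integral from [s]. It plays the role of integration by
    parts throughout. *)
Lemma integral_mass m a b (g : R -> R) : mu.-integrable `]a, b[ (EFin \o g) ->
  \int[mu]_(t in `]a, b[) (g t * mass m a t) = \int[m]_(s in `]a, b[) tail_integral b g s.
Proof.
move=> ig.
pose A := [set z : measurableTypeR R * measurableTypeR R | a < z.2 <= z.1].
pose U := g \_ `]a, b[.
pose f (z : measurableTypeR R * measurableTypeR R) : \bar R := (U z.1 * \1_A z)%:E.
have mU : measurable_fun [set: measurableTypeR R] U.
  by apply/(measurable_restrictT _ _).1 => //; apply/measurable_EFinP; exact: measurable_int ig.
have iU : mu.-integrable setT (EFin \o U).
  by rewrite -restrict_EFin; apply/integrable_restrict => //=; rewrite setTI.
have mf : measurable_fun setT f.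
  apply/measurable_EFinP; apply: measurable_funM.
    by apply: measurableT_comp => //; exact: measurable_fst.
  by apply: measurable_indic; exact: fubini_set_measurable.
have indA t s : \1_A (t, s) = \1_`]a, t] s :> R.
  by rewrite !indicE; congr (_%:R); congr nat_of_bool; apply/idP/idP; rewrite !inE/= in_itv.
have inner1 (V : R -> R) t :
    (\int[m]_s (V t * \1_A (t, s))%:E = (V t)%:E * m `]a, t]%classic)%E.
  under eq_integral do rewrite indA EFinM.
  rewrite integralZl//; last exact: integrable_indic.
  by rewrite integral_indic// setIT.
have inner2 s : (\int[mu]_t f (t, s) = ((tail_integral b g \_ `]a, b[) s)%:E)%E.
  rewrite patchE; case: ifPn => [|sab].
    rewrite inE/= in_itv/= => /andP[as_ sb].
    have igs : mu.-integrable `[s, b[ (EFin \o g).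
      by apply: integrableS ig => // t /=; rewrite !in_itv/= => /andP[/(lt_le_trans as_) -> ->].
    rewrite /tail_integral /Rintegral fineK; last exact: integrable_fin_num.
    rewrite [RHS]integral_mkcond; apply: eq_integral => t _.
    rewrite /f /U/= indA !patchE indicE.
    have [tsb|tsb] := boolP (t \in `[s, b[%classic).
      move: tsb; rewrite inE/= in_itv/= => /andP[st tb].
      by rewrite !mem_set ?mulr1//= in_itv/= ?as_ ?st ?tb// (lt_le_trans as_ st).
    case: ifPn => [tab|]; last by rewrite mul0r.
    rewrite memNset ?mulr0//= => /=; rewrite in_itv/= as_ /= => st.
    by move: tsb tab; rewrite notin_setE inE/= !in_itv/= st/= => tb /andP[_ /tb].
  rewrite [LHS](_ : _ = \int[mu]_t (cst 0 t))%E; first by rewrite integral0.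
  apply: eq_integral => t _; rewrite /f /U/= indA patchE indicE.
  case: ifPn => [|]; last by rewrite mul0r.
  rewrite inE/= in_itv/= => /andP[at_ tb].
  rewrite memNset ?mulr0//= in_itv/= => /andP[as_ st].
  by move: sab; rewrite notin_setE/= in_itv/= as_ (le_lt_trans st tb).
(* Absolute integrability holds because [mass m a] is bounded by the total mass of [m]. *)
have iF : (mu \x m)%E.-integrable setT f.
  apply/integrable12ltyP => //.
  have -> : (\int[mu]_t \int[m]_s `|f (t, s)| = \int[mu]_t (`|U t * mass m a t|)%:E)%E.
    apply: eq_integral => t _; rewrite normrM (ger0_norm (mass_ge0 _ _ _)) EFinM.
    rewrite fineK ?fin_num_measure// -(inner1 (fun t => `|U t|)).
    apply: eq_integral => s _.
    by rewrite /f abse_EFin normrM [`|\1_A _|]ger0_norm ?indic_ge0.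
  have : mu.-integrable setT ((EFin \o U) \* (EFin \o mass m a))%E.
    by apply: integrableMl => //; [exact: measurable_mass|exact: bounded_mass].
  by move=> /integrableP[].
have FF : (\int[mu]_t \int[m]_s f (t, s) = \int[m]_s ((tail_integral b g \_ `]a, b[) s)%:E)%E.
  by rewrite (Fubini iF); apply: eq_integral => s _; exact: inner2.
rewrite /Rintegral [in RHS]integral_mkcond restrict_EFin -FF.
rewrite [in LHS]integral_mkcond; congr fine; apply: eq_integral => t _.
rewrite inner1 -[m _]fineK ?fin_num_measure// -EFinM restrict_EFin/= /U !patchE.
by case: ifPn => // _; rewrite mul0r.
Qed.

End integral_of_mass.

Section derivative_of_mass.
Context {R : realType}.
Notation mu := (@lebesgue_measure R).
Implicit Types (a b s t : R).

Lemma tail_integral_derive1 a b (phi : R -> R) s : test_function a b phi ->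
  s \in `]a, b[ -> tail_integral b (derive1 phi) s = - phi s.
Proof.
move=> tphi; rewrite in_itv/= => /andP[_ sb].
have dphi t : is_derive t 1 phi (derive1 phi t).
  by apply: derivable_is_derive; exact: test_function_derivable tphi t.
rewrite /tail_integral (Rintegral_derive true true (ltW sb) dphi); last first.
  exact: test_function_derive1_continuous tphi.
by rewrite (test_function_out tphi) ?sub0r// in_itv/= ltxx andbF.
Qed.

Lemma test_function_derive1_integrable a b (phi : R -> R) : test_function a b phi ->
  mu.-integrable `]a, b[ (EFin \o (derive1 phi : R -> R)).
Proof.
move=> tphi; apply: continuous_integrable_itv.
exact: test_function_derive1_continuous tphi.
Qed.

(** The case [g = derive1 phi] of [integral_mass]: as [phi] vanishes at [b], the tail integral of
    its derivative is [- phi]. *)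
Lemma mass_derivative (m : {finite_measure set (measurableTypeR R) -> \bar R}) a b phi :
  test_function a b phi ->
  \int[mu]_(t in `]a, b[) (mass m a t * derive1 phi t) = - \int[m]_(t in `]a, b[) phi t.
Proof.
move=> tphi.
have := integral_mass m (test_function_derive1_integrable tphi).
under eq_Rintegral do rewrite mulrC.
move=> ->; rewrite -mulN1r -RintegralZl//.
  apply: eq_Rintegral => s; rewrite inE/= => sab.
  by rewrite (tail_integral_derive1 tphi sab) mulN1r.
have [M phiM] := test_function_bounded tphi.
apply: measurable_bounded_integrable => //.
- by rewrite ltey_eq fin_num_measure.
- apply: measurable_funTS; apply: continuous_measurable_fun.
  exact: test_function_continuous tphi.
- by exists M; split; [exact: num_real|move=> N /ltW MN t _ /=; exact: le_trans (phiM t) MN].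
Qed.

End derivative_of_mass.

(** * Charges as differences of measures *)

Section charges.
Context d (T : measurableType d) (R : realType).
Implicit Types (nu : {charge set T -> \bar R}) (m n : {finite_measure set T -> \bar R}).
Implicit Types (A D : set T) (f g : T -> R).

Lemma EFin_Rintegral (m : {measure set T -> \bar R}) D f : measurable D ->
  m.-integrable D (EFin \o f) ->
  (\int[m]_(t in D) (f t)%:E = (\int[m]_(t in D) f t)%:E)%E.
Proof. by move=> mD fi; rewrite fineK//; exact: integrable_fin_num. Qed.

Lemma integrable_scale (m : {measure set T -> \bar R}) D f (k : R) : measurable D ->
  m.-integrable D (EFin \o f) -> m.-integrable D (EFin \o (fun t => k * f t)).
Proof.
move=> mD fi; rewrite (_ : EFin \o _ = (fun t => k%:E * (f t)%:E)%E)//.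
by apply: integrableZl.
Qed.

Lemma integrable_add (m : {measure set T -> \bar R}) D f g : measurable D ->
  m.-integrable D (EFin \o f) -> m.-integrable D (EFin \o g) ->
  m.-integrable D (EFin \o (fun t => f t + g t)).
Proof.
move=> mD fi gi; rewrite (_ : EFin \o _ = (EFin \o f) \+ (EFin \o g))%E//.
exact: integrableD.
Qed.

Lemma integrable_sub (m : {measure set T -> \bar R}) D f g : measurable D ->
  m.-integrable D (EFin \o f) -> m.-integrable D (EFin \o g) ->
  m.-integrable D (EFin \o (fun t => f t - g t)).
Proof.
move=> mD fi gi; rewrite (_ : EFin \o _ = (EFin \o f) \- (EFin \o g))%E//.
exact: integrableB.
Qed.

Lemma charge_posE nu A : measurable A ->
  charge_pos_variation nu A = nu (A `&` (hahn_pair nu).1).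
Proof.
move=> mA; rewrite -[LHS]/(jordan_pos (hahn_pairP nu) A).
by rewrite jordan_posE cjordan_posE /crestr0 mem_set.
Qed.

Lemma charge_negE nu A : measurable A ->
  charge_neg_variation nu A = (- nu (A `&` (hahn_pair nu).2))%E.
Proof.
move=> mA; rewrite -[LHS]/(jordan_neg (hahn_pairP nu) A).
by rewrite jordan_negE cjordan_negE /crestr0 mem_set.
Qed.

Lemma charge_total_variationE nu A :
  charge_total_variation nu A = (charge_pos_variation nu A + charge_neg_variation nu A)%E.
Proof. by []. Qed.

Lemma charge_decomp nu A : measurable A ->
  nu A = (charge_pos_variation nu A - charge_neg_variation nu A)%E.
Proof.
by move=> mA; rewrite (jordan_decomp (hahn_pairP nu) mA) /cadd/= cscaleN1.
Qed.

Definition charge_diff m n : set T -> \bar R :=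
  cadd (charge_of_finite_measure m) (copp (charge_of_finite_measure n)).

HB.instance Definition _ m n := Charge.on (charge_diff m n).

(** Minimality of the Jordan decomposition: the positive variation is [m - n] restricted to the
    positive Hahn set, where dropping [n] and then the restriction only increases it. *)
Lemma charge_diff_pos_le m n A : measurable A ->
  (charge_pos_variation (charge_diff m n) A <= m A)%E.
Proof.
move=> mA; have [[mP _] _ _ _] := hahn_pairP (charge_diff m n).
have mAP := measurableI _ _ mA mP.
rewrite charge_posE//; move: mAP; set B := A `&` _ => mB.
rewrite -[leLHS]/(m B - n B)%E.
rewrite leeBlDr ?fin_num_measure// (le_trans (_ : _ <= m A)%E)//.
  by apply: le_measure; rewrite ?inE//; exact: subIsetl.
by rewrite leeDl.
Qed.

Lemma charge_diff_neg_le m n A : measurable A ->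
  (charge_neg_variation (charge_diff m n) A <= n A)%E.
Proof.
move=> mA; have [_ [mN _] _ _] := hahn_pairP (charge_diff m n).
have mAN := measurableI _ _ mA mN.
rewrite charge_negE//; move: mAN; set B := A `&` _ => mB.
rewrite -[leLHS]/(- (m B - n B))%E.
rewrite oppeB; last by rewrite fin_num_adde_defr// fin_num_measure.
rewrite addeC leeBlDr ?fin_num_measure// (le_trans (_ : _ <= n A)%E)//.
  by apply: le_measure; rewrite ?inE//; exact: subIsetl.
by rewrite leeDl.
Qed.

Lemma bounded_fun_integrable m D f (M : R) : measurable D -> measurable_fun D f ->
  (forall t, D t -> `|f t| <= M) -> m.-integrable D (EFin \o f).
Proof.
move=> mD mf fM; apply: measurable_bounded_integrable => //.
  by rewrite ltey_eq fin_num_measure.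
by exists M; split; [exact: num_real|move=> N /ltW MN t Dt /=; exact: le_trans (fM t Dt) MN].
Qed.

(** With [p] and [q] the Jordan parts, [p - q = m - n] is rewritten as the equality of measures
    [p + n = q + m], whose integrals agree and can then be rearranged since all four are finite. *)
Lemma charge_diff_Rintegral m n D f (M : R) : measurable D -> measurable_fun D f ->
  (forall t, D t -> `|f t| <= M) ->
  charge_Rintegral (charge_diff m n) D f = \int[m]_(t in D) f t - \int[n]_(t in D) f t.
Proof.
move=> mD mf fM; rewrite /charge_Rintegral.
set p := charge_pos_variation _; set q := charge_neg_variation _.
have i (k : {finite_measure set T -> \bar R}) : k.-integrable D (EFin \o f).
  exact: bounded_fun_integrable mD mf fM.
have fi (k : {finite_measure set T -> \bar R}) : (\int[k]_(t in D) (f t)%:E)%E \is a fin_num.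
  by apply: integrable_fin_num => //; exact: i.
have : (\int[measure_add p n]_(t in D) (f t)%:E = \int[measure_add q m]_(t in D) (f t)%:E)%E.
  apply: eq_measure_integral => A mA _.
  transitivity (p A + n A)%E; first exact: measure_addE.
  transitivity (q A + m A)%E; last by apply/esym; exact: measure_addE.
  have : (m A - n A = p A - q A)%E := charge_decomp (charge_diff m n) mA.
  rewrite -[p A]fineK ?fin_num_measure// -[q A]fineK ?fin_num_measure//.
  rewrite -[m A]fineK ?fin_num_measure// -[n A]fineK ?fin_num_measure//.
  rewrite -!EFinB -!EFinD => -[E]; congr (_%:E); lra.
rewrite !integral_measure_add//;
  try solve [exact: i | exact/measurable_EFinP].
rewrite /Rintegral -(fineK (fi p)) -(fineK (fi q)) -(fineK (fi m)) -(fineK (fi n)).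
by rewrite -!EFinD => -[E] /=; lra.
Qed.

Lemma total_variation_integral nu D f : measurable D -> measurable_fun D f ->
  (forall t, D t -> 0 <= f t) ->
  (\int[charge_total_variation nu]_(t in D) (f t)%:E =
   \int[charge_pos_variation nu]_(t in D) (f t)%:E +
   \int[charge_neg_variation nu]_(t in D) (f t)%:E)%E.
Proof.
move=> mD mf f0.
rewrite -ge0_integral_measure_add//; last by apply/measurable_EFinP.
by apply: eq_measure_integral => A mA _; apply/esym; exact: measure_addE.
Qed.

Lemma integral_le_measure (m n : {measure set T -> \bar R}) D f :
  measurable D -> measurable_fun D f ->
  (forall t, D t -> 0 <= f t) -> (forall A, measurable A -> m A <= n A)%E ->
  (\int[m]_(t in D) (f t)%:E <= \int[n]_(t in D) (f t)%:E)%E.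
Proof.
move=> mD mf f0 mn.
have E (k : {measure set T -> \bar R}) :
    (\int[k]_(t in D) (f t)%:E = \int[k]_(t in D) ((f \_ D) t)%:E)%E.
  by apply: eq_integral => t tD; rewrite patchE tD.
rewrite !E; apply: ge0_le_measure_integral => //.
  by move=> t; rewrite lee_fin patchE; case: ifPn => // /set_mem /f0.
by apply/measurable_EFinP; apply/(measurable_restrictT _ _).1.
Qed.

Lemma charge_diff_total_variation_le m n D f : measurable D -> measurable_fun D f ->
  (forall t, D t -> 0 <= f t) ->
  (\int[charge_total_variation (charge_diff m n)]_(t in D) (f t)%:E <=
   \int[m]_(t in D) (f t)%:E + \int[n]_(t in D) (f t)%:E)%E.
Proof.
move=> mD mf f0; rewrite total_variation_integral//.
by apply: leeD; apply: integral_le_measure => // A mA;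
  [exact: charge_diff_pos_le|exact: charge_diff_neg_le].
Qed.

Definition addscale m n (r : {nonneg R}) : set T -> \bar R := measure_add m (mscale r n).

HB.instance Definition _ m n r := Measure.on (addscale m n r).

Let addscale_fin m n r : fin_num_fun (addscale m n r).
Proof.
by move=> A mA; rewrite [addscale _ _ _ _]measure_addE fin_numD !fin_num_measure.
Qed.

HB.instance Definition _ m n r :=
  @Measure_isFinite.Build _ _ _ (addscale m n r) (@addscale_fin m n r).

Lemma addscaleE m n r A : addscale m n r A = (m A + r%:num%:E * n A)%E.
Proof. exact: measure_addE. Qed.

Lemma Rintegral_mscale m (r : {nonneg R}) D f (M : R) : measurable D -> measurable_fun D f ->
  (forall t, D t -> `|f t| <= M) ->
  \int[mscale r m]_(t in D) f t = r%:num * \int[m]_(t in D) f t.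
Proof.
move=> mD mf fM; have i := bounded_fun_integrable m mD mf fM.
have fi := integrable_fin_num mD i.
rewrite /Rintegral -[RHS]/(fine r%:num%:E * _) -fineM//; congr fine.
have mE : measurable_fun D (EFin \o f) by apply/measurable_EFinP.
rewrite [LHS]integralE [in RHS]integralE !ge0_integral_mscale//; last 2 first.
  exact: measurable_funeneg.
  exact: measurable_funepos.
rewrite [RHS]muleBr// fin_num_adde_defl//.
by rewrite fin_numN; exact: integrable_neg_fin_num.
Qed.

Lemma Rintegral_addscale m n r D f (M : R) : measurable D -> measurable_fun D f ->
  (forall t, D t -> `|f t| <= M) ->
  \int[addscale m n r]_(t in D) f t = \int[m]_(t in D) f t + r%:num * \int[n]_(t in D) f t.
Proof.
move=> mD mf fM.
have i (k : {finite_measure set T -> \bar R}) : k.-integrable D (EFin \o f).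
  exact: bounded_fun_integrable mD mf fM.
rewrite -(Rintegral_mscale n r mD mf fM) /Rintegral integral_measure_add//;
  try solve [exact: i | exact: (i (mscale r n)) | exact/measurable_EFinP].
by rewrite fineD//; apply: integrable_fin_num => //; [exact: i|exact: (i (mscale r n))].
Qed.

End charges.

(** * Increments and continuity of tail integrals *)

Section tail_integral_theory.
Context {R : realType}.
Notation mu := (@lebesgue_measure R).
Implicit Types (a b p q s t : R) (g : R -> R).

Lemma restrict_integrable a b g (D : set R) : measurable D ->
  mu.-integrable `]a, b[ (EFin \o g) -> mu.-integrable D (EFin \o (g \_ `]a, b[)).
Proof.
move=> mD ig; apply: (@integrableS _ _ _ mu setT) => //.
by rewrite -restrict_EFin; apply/integrable_restrict => //=; rewrite setTI.
Qed.

Lemma Rintegral_restrict a b g (D : set R) : D `<=` `]a, b[ ->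
  \int[mu]_(t in D) (g \_ `]a, b[) t = \int[mu]_(t in D) g t.
Proof.
by move=> Dab; apply: eq_Rintegral => t /set_mem Dt; rewrite patchE mem_set//; exact: Dab.
Qed.

(** Extending [g] by 0 makes it integrable on the closed interval, so the tail becomes a constant
    minus an indefinite integral, whose continuity and increments are known. *)
Lemma tail_integralE a b g s : s \in `]a, b[ -> mu.-integrable `]a, b[ (EFin \o g) ->
  tail_integral b g s = \int[mu]_(t in `[a, b]) (g \_ `]a, b[) t -
    \int[mu]_(t in `[a, s]) (g \_ `]a, b[) t.
Proof.
rewrite in_itv/= => /andP[as_ sb] ig; rewrite (@Rintegral_itvB _ _ (BLeft a) (BRight b)).
- rewrite -Rintegral_itv_bndo_bndc; last exact: restrict_integrable.
  rewrite Rintegral_itv_obnd_cbnd; last exact: restrict_integrable.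
  rewrite Rintegral_restrict// => t /=; rewrite !in_itv/= => /andP[st ->].
  by rewrite (lt_le_trans as_ st).
- exact: restrict_integrable.
- by rewrite bnd_simp ltW.
- by rewrite bnd_simp ltW.
Qed.

Lemma tail_integralB a b g p q : a < p -> p <= q -> q < b ->
  mu.-integrable `]a, b[ (EFin \o g) ->
  tail_integral b g p - tail_integral b g q = \int[mu]_(t in `]p, q]) g t.
Proof.
move=> ap pq qb ig.
rewrite !(tail_integralE (a := a))// ?in_itv/= ?ap ?qb ?(le_lt_trans pq qb) ?(lt_le_trans ap pq)//.
rewrite -(@Rintegral_restrict a b g `]p, q]); last first.
  move=> t /=; rewrite !in_itv/= => /andP[pt tq].
  by rewrite (lt_trans ap pt) (le_lt_trans tq qb).
rewrite -(@Rintegral_itvB _ _ (BLeft a) (BRight q)); first lra.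
- exact: restrict_integrable.
- by rewrite bnd_simp ltW.
- by rewrite bnd_simp.
Qed.

Lemma tail_integral_continuous a b g s : s \in `]a, b[ ->
  mu.-integrable `]a, b[ (EFin \o g) -> {for s, continuous (tail_integral b g)}.
Proof.
move=> sab ig; have ltab : a < b.
  by move: sab; rewrite in_itv/= => /andP[as_]; exact: lt_trans as_.
have := @parameterized_integral_continuous _ a b (g \_ `]a, b[) (ltW ltab).
move=> /(_ (restrict_integrable (measurable_itv _) ig)) cP.
have cs : {for s, continuous (fun x => \int[mu]_(t in `[a, x]) (g \_ `]a, b[) t)}.
  exact: (within_continuous_continuous ltab cP sab).
rewrite /prop_for /continuous_at (tail_integralE sab ig).
have : \int[mu]_(t in `[a, b]) (g \_ `]a, b[) t -
    \int[mu]_(t in `[a, x]) (g \_ `]a, b[) t @[x --> s] -->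
  \int[mu]_(t in `[a, b]) (g \_ `]a, b[) t - \int[mu]_(t in `[a, s]) (g \_ `]a, b[) t.
  by apply: cvgB; [exact: cvg_cst|exact: cs].
apply: cvg_trans; apply: near_eq_cvg; near=> x.
rewrite -tail_integralE//; near: x.
by apply: near_in_itvoo.
Unshelve. all: by end_near. Qed.

Lemma measurable_tail_integral a b g : mu.-integrable `]a, b[ (EFin \o g) ->
  measurable_fun `]a, b[ (tail_integral b g).
Proof.
move=> ig; apply: open_continuous_measurable_fun; first exact: itv_open.
by move=> s; rewrite inE/= => sab; exact: tail_integral_continuous ig.
Qed.

End tail_integral_theory.

(** * The energy and its first variation *)

Section bv_functions.
Context {R : realType}.
Notation mu := (@lebesgue_measure R).
Implicit Types (a b c t : R) (u v w g : R -> R).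
Implicit Types m n : {finite_measure set (measurableTypeR R) -> \bar R}.
Implicit Types nu : {charge set (measurableTypeR R) -> \bar R}.

Lemma lebesgue_measure_itv_lty a b (bl br : bool) :
  (mu [set` Interval (BSide bl a) (BSide br b)] < +oo)%E.
Proof. by rewrite lebesgue_measure_itv/=; case: ifP => // _; rewrite -EFinD ltry. Qed.

Definition concentrated a b (m : set (measurableTypeR R) -> \bar R) :=
  forall A : set (measurableTypeR R), measurable A -> A `&` `]a, b[ = set0 -> m A = 0%E.

Lemma charge_pos_concentrated a b nu : concentrated a b nu ->
  concentrated a b (charge_pos_variation nu).
Proof.
move=> nuab A mA Aab; have [[mP _] _ _ _] := hahn_pairP nu.
rewrite charge_posE// nuab//; first exact: measurableI.
by rewrite setIAC Aab set0I.
Qed.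

Lemma charge_neg_concentrated a b nu : concentrated a b nu ->
  concentrated a b (charge_neg_variation nu).
Proof.
move=> nuab A mA Aab; have [_ [mN _] _ _] := hahn_pairP nu.
rewrite charge_negE// nuab ?oppe0//; first exact: measurableI.
by rewrite setIAC Aab set0I.
Qed.

Lemma test_function_measurable a b phi (D : set R) : test_function a b phi ->
  measurable_fun D phi.
Proof.
move=> tphi; apply: measurable_funTS; apply: continuous_measurable_fun.
exact: test_function_continuous tphi.
Qed.

Lemma BV_deriv_charge_diff a b u m n : mu.-integrable `]a, b[ (EFin \o u) ->
  concentrated a b m -> concentrated a b n -> deriv_pair a b u m n ->
  BV_deriv a b u (charge_diff m n).
Proof.
move=> iu cm cn dp; split=> //.
  by move=> A mA Aab; rewrite -[LHS]/(m A - n A)%E cm// cn// sube0.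
move=> phi tphi; rewrite dp//.
have [M phiM] := test_function_bounded tphi.
by rewrite (@charge_diff_Rintegral _ _ _ m n `]a, b[ phi M)//; exact: test_function_measurable tphi.
Qed.

Lemma BV_deriv_pair a b u nu : BV_deriv a b u nu ->
  deriv_pair a b u (charge_pos_variation nu) (charge_neg_variation nu).
Proof. by case. Qed.

Lemma BV_deriv_ae a b u nu : a < b -> BV_deriv a b u nu ->
  exists c, {ae mu, forall t, t \in `]a, b[ ->
    u t = c + (mass (charge_pos_variation nu) a t - mass (charge_neg_variation nu) a t)}.
Proof.
by move=> ab bu; apply: deriv_pair_ae => //; [exact: BV_deriv_pair|case: bu].
Qed.

Lemma BV_deriv_ae_bounded a b u nu : a < b -> BV_deriv a b u nu ->
  exists M, {ae mu, forall t, t \in `]a, b[ -> `|u t| <= M}.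
Proof.
move=> ab bu; have [c aeu] := BV_deriv_ae ab bu.
exists (`|c| + fine (charge_pos_variation nu setT) + fine (charge_neg_variation nu setT)).
apply: (@filterS _ _ (ae_filter_ringOfSetsType mu) _ _ _ aeu) => t ut /ut ->.
rewrite -addrA (le_trans (ler_normD _ _))// lerD2l (le_trans (ler_normB _ _))//.
by rewrite lerD// ger0_norm ?mass_ge0// mass_le.
Qed.

(** Almost everywhere [g ^+ 2] is at most a constant times the absolute value of [g]. As BV
    functions on an interval are bounded almost everywhere, the quadratic terms of the energy are
    finite. *)
Lemma square_integrable a b g (M : R) : mu.-integrable `]a, b[ (EFin \o g) ->
  {ae mu, forall t, t \in `]a, b[ -> `|g t| <= M} ->
  mu.-integrable `]a, b[ (EFin \o (fun t => g t ^+ 2)).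
Proof.
move=> ig aeg.
have mg : measurable_fun `]a, b[ g by apply/measurable_EFinP; exact: measurable_int ig.
have mg2 : measurable_fun `]a, b[ (fun t => g t ^+ 2) by exact: measurable_funX.
apply/integrableP; split; first exact/measurable_EFinP.
pose N : R := Num.max M 0.
have iN : mu.-integrable `]a, b[ (fun t => N%:E * `|(g t)%:E|)%E.
  by apply: integrableZl => //; exact: (integrable_abse ig).
apply: (@le_lt_trans _ _ (\int[mu]_(t in `]a, b[) (N%:E * `|(g t)%:E|))%E); last first.
  exact: integrable_lty.
apply: ae_ge0_le_integral => //.
- by apply: measurableT_comp => //; exact/measurable_EFinP.
- by move=> t _; rewrite mule_ge0// lee_fin le_max lexx orbT.
- exact: measurable_int iN.
apply: (@filterS _ _ (ae_filter_ringOfSetsType mu) _ _ _ aeg) => t gM tab.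
rewrite /= -EFinM lee_fin normrX expr2 ler_wpM2r//.
by rewrite le_max gM.
Qed.

End bv_functions.

Section energy.
Context {R : realType}.
Notation mu := (@lebesgue_measure R).
Implicit Types (a b c t : R) (f u v w g : R -> R).
Implicit Types m n : {finite_measure set (measurableTypeR R) -> \bar R}.
Implicit Types nu : {charge set (measurableTypeR R) -> \bar R}.

Variables (a b : R) (f alpha : R -> R) (K : R).
Hypotheses (malpha : measurable_fun `]a, b[ alpha)
  (alpha0 : forall t, `]a, b[%classic t -> 0 <= alpha t)
  (alphaK : forall t, `]a, b[%classic t -> `|alpha t| <= K).

Let I m := \int[m]_(t in `]a, b[) alpha t.

Let EFinI m : (\int[m]_(t in `]a, b[) (alpha t)%:E = (I m)%:E)%E.
Proof.
apply: EFin_Rintegral => //.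
exact: (bounded_fun_integrable m (measurable_itv _) malpha alphaK).
Qed.

Lemma tv_energyE u nu : mu.-integrable `]a, b[ (EFin \o (fun t => (f t - u t) ^+ 2)) ->
  tv_energy a b f alpha u nu = (2^-1 * \int[mu]_(t in `]a, b[) (f t - u t) ^+ 2 +
    (I (charge_pos_variation nu) + I (charge_neg_variation nu)))%:E.
Proof.
move=> iq; rewrite /tv_energy total_variation_integral// !EFinI.
by rewrite EFin_Rintegral.
Qed.

(** Only an inequality, since [m] and [n] may partly cancel; an upper bound is what is wanted both
    for competitors of a minimizer and for a candidate minimizer. *)
Lemma tv_energy_charge_diff_le v m n :
  mu.-integrable `]a, b[ (EFin \o (fun t => (f t - v t) ^+ 2)) ->
  (tv_energy a b f alpha v (charge_diff m n) <=
   (2^-1 * \int[mu]_(t in `]a, b[) (f t - v t) ^+ 2 + (I m + I n))%:E)%E.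
Proof.
move=> iq; rewrite /tv_energy [X in (_ * X + _)%E]EFin_Rintegral// [leRHS]EFinD EFinM.
apply: leeD => //.
have := @charge_diff_total_variation_le _ _ _ m n `]a, b[ alpha (measurable_itv _) malpha alpha0.
by rewrite !EFinI -EFinD.
Qed.

Lemma Rintegral_square_expand g w (r : R) : mu.-integrable `]a, b[ (EFin \o g) ->
  mu.-integrable `]a, b[ (EFin \o (fun t => g t ^+ 2)) ->
  measurable_fun `]a, b[ w -> (exists M, forall t, `|w t| <= M) ->
  mu.-integrable `]a, b[ (EFin \o (fun t => (g t - r * w t) ^+ 2)) /\
  \int[mu]_(t in `]a, b[) (g t - r * w t) ^+ 2 =
  \int[mu]_(t in `]a, b[) g t ^+ 2 - 2 * r * \int[mu]_(t in `]a, b[) (g t * w t) +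
  r ^+ 2 * \int[mu]_(t in `]a, b[) w t ^+ 2.
Proof.
move=> ig ig2 mw [M wM].
have bw (D : set R) : [bounded w t | t in D].
  by exists M; split; [exact: num_real|move=> N /ltW MN t _ /=; exact: le_trans (wM t) MN].
have igw : mu.-integrable `]a, b[ (EFin \o (fun t => g t * w t)).
  by have := @integrableMl _ _ _ mu `]a, b[ (measurable_itv _) _ w ig mw (bw _).
have iw2 : mu.-integrable `]a, b[ (EFin \o (fun t => w t ^+ 2)).
  apply: measurable_bounded_integrable => //.
  - exact: lebesgue_measure_itv_lty.
  - exact: measurable_funX.
  - exists (M ^+ 2); split; first exact: num_real.
    move=> N /ltW MN t _ /=; apply: le_trans MN.
    by rewrite normrX lerXn2r ?nnegrE// (le_trans _ (wM t)).
have i1 : mu.-integrable `]a, b[ (EFin \o (fun t => (2 * r) * (g t * w t))).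
  exact: integrable_scale.
have i2 : mu.-integrable `]a, b[ (EFin \o (fun t => r ^+ 2 * w t ^+ 2)).
  exact: integrable_scale.
have i3 : mu.-integrable `]a, b[ (EFin \o (fun t => g t ^+ 2 - (2 * r) * (g t * w t))).
  exact: integrable_sub.
have E t : (g t - r * w t) ^+ 2 = g t ^+ 2 - (2 * r) * (g t * w t) + r ^+ 2 * w t ^+ 2 by ring.
split.
  by rewrite (funext E); exact: integrable_add.
under eq_Rintegral do rewrite E.
by rewrite RintegralD// RintegralB// !RintegralZl.
Qed.

(** Minimality is tested against [u + r * w]; expanding the square, the terms without [r] cancel.
    The sign of [r] is free. *)
Lemma tv_solution_first_variation u Du w (r : R) m n :
  tv_solution a b f alpha u Du ->
  mu.-integrable `]a, b[ (EFin \o (fun t => f t - u t)) ->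
  mu.-integrable `]a, b[ (EFin \o (fun t => (f t - u t) ^+ 2)) ->
  measurable_fun `]a, b[ w -> (exists M, forall t, `|w t| <= M) ->
  concentrated a b m -> concentrated a b n ->
  deriv_pair a b (fun t => u t + r * w t) m n ->
  I (charge_pos_variation Du) + I (charge_neg_variation Du) +
    r * \int[mu]_(t in `]a, b[) ((f t - u t) * w t) <=
  r ^+ 2 * (2^-1 * \int[mu]_(t in `]a, b[) w t ^+ 2) + (I m + I n).
Proof.
move=> [bu minu] ig ig2 mw wM cm cn dp.
have [iq Eq] := Rintegral_square_expand r ig ig2 mw wM.
have Ev t : f t - (u t + r * w t) = f t - u t - r * w t by ring.
have iv : mu.-integrable `]a, b[ (EFin \o (fun t => (f t - (u t + r * w t)) ^+ 2)).
  by rewrite (_ : (fun t => _) = (fun t => (f t - u t - r * w t) ^+ 2))//;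
    apply/funext => t; rewrite Ev.
have iu : mu.-integrable `]a, b[ (EFin \o u) by case: bu.
have [M wM'] := wM.
have irw : mu.-integrable `]a, b[ (EFin \o (fun t => u t + r * w t)).
  have iw : mu.-integrable `]a, b[ (EFin \o w).
    apply: measurable_bounded_integrable => //.
    - exact: lebesgue_measure_itv_lty.
    - by exists M; split; [exact: num_real|move=> N /ltW MN t _ /=; exact: le_trans (wM' t) MN].
  by apply: integrable_add => //; exact: integrable_scale.
have := minu _ _ (BV_deriv_charge_diff irw cm cn dp).
rewrite (tv_energyE _ ig2) => /le_trans /(_ (tv_energy_charge_diff_le m n iv)).
rewrite lee_fin; under [X in _ <= _ * X + _]eq_Rintegral do rewrite Ev.
rewrite Eq.
move: (\int[mu]_(t in _) _) (\int[mu]_(t in _) _) (\int[mu]_(t in _) _) => x y z.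
move: (I _) (I _) (I _) (I _) => i1 i2 i3 i4.
nra.
Qed.

End energy.

(** * Optimality conditions *)

Section optimality.
Context {R : realType}.
Notation mu := (@lebesgue_measure R).
Implicit Types (a b c p t r : R) (f u v w g : R -> R).
Implicit Types m n k : {finite_measure set (measurableTypeR R) -> \bar R}.

Definition delta p : {finite_measure set (measurableTypeR R) -> \bar R} :=
  @dirac _ (measurableTypeR R) p R.

Lemma deltaE p (A : set R) : delta p A = (\1_A p)%:E.
Proof. by rewrite -[LHS]/(\d_p A) diracE. Qed.

Lemma mass_bounded m a : exists M, forall t, `|mass m a t| <= M.
Proof.
exists (fine (m setT)) => t; rewrite ger0_norm ?mass_ge0//; exact: mass_le.
Qed.

(** The relation [m' - n' = m - n + r * k] is required only after testing, which leaves open whether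
    [r * k] is added to one part or removed from the other, according to the sign of [r]. *)
Lemma deriv_pair_add a b u r k m n m' n' : mu.-integrable `]a, b[ (EFin \o u) ->
  deriv_pair a b u m n ->
  (forall phi, test_function a b phi ->
    \int[m']_(t in `]a, b[) phi t - \int[n']_(t in `]a, b[) phi t =
    \int[m]_(t in `]a, b[) phi t - \int[n]_(t in `]a, b[) phi t +
    r * \int[k]_(t in `]a, b[) phi t) ->
  deriv_pair a b (fun t => u t + r * mass k a t) m' n'.
Proof.
move=> iu dp E phi tphi; rewrite E//.
have iphi := test_function_derive1_integrable tphi.
have [M phiM] : exists M, forall t : R, `]a, b[%classic t -> `|derive1 phi t| <= M.
  have [M HM] := @continuous_bounded_itv _ _ a b
    (continuous_subspaceT (test_function_derive1_continuous tphi)).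
  by exists M => t /=; rewrite in_itv/= => /andP[at_ tb]; rewrite HM// !ltW.
have mphi : measurable_fun `]a, b[ (derive1 phi : R -> R).
  by apply/measurable_EFinP; exact: measurable_int iphi.
have iuphi : mu.-integrable `]a, b[ (EFin \o (fun t => u t * derive1 phi t)).
  have := @integrableMl _ _ _ mu `]a, b[ (measurable_itv _) _ (derive1 phi : R -> R) iu mphi.
  apply; exists M; split; first exact: num_real.
  by move=> N /ltW MN t tab /=; exact: le_trans (phiM t tab) MN.
have imphi : mu.-integrable `]a, b[ (EFin \o (fun t => mass k a t * derive1 phi t)).
  have := @integrableMr _ _ _ mu `]a, b[ (measurable_itv _) (mass k a)
    (EFin \o (derive1 phi : R -> R)).
  by apply=> //; [exact: measurable_mass|exact: bounded_mass].
under eq_Rintegral do rewrite mulrDl -mulrA.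
rewrite RintegralD//; last exact: integrable_scale.
rewrite RintegralZl// mass_derivative// dp//; lra.
Qed.

Lemma Rintegral_dirac a b p f : p \in `]a, b[ -> measurable_fun `]a, b[ f ->
  \int[(delta p)]_(t in `]a, b[) f t = f p.
Proof.
move=> pab mf; rewrite /Rintegral integral_dirac//; last exact/measurable_EFinP.
by rewrite diracE mem_set// mul1e.
Qed.

Lemma dirac_concentrated a b p : p \in `]a, b[ -> concentrated a b (delta p).
Proof.
move=> pab A mA A0; rewrite deltaE indicE memNset// => Ap.
by rewrite -[False]/(set0 p) -A0.
Qed.

Lemma addscale_concentrated a b m n (r : {nonneg R}) : concentrated a b m -> concentrated a b n ->
  concentrated a b (addscale m n r).
Proof. by move=> cm cn A mA A0; rewrite addscaleE cm// cn// mule0 adde0. Qed.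

Lemma mscale_concentrated a b m (r : {nonneg R}) : concentrated a b m ->
  concentrated a b (mscale r m).
Proof. by move=> cm A mA A0; rewrite -[LHS]/(r%:num%:E * m A)%E cm// mule0. Qed.

(** Division by [r] followed by [r] tending to 0. The range stops at 1 because the scaling factor
    [1 - r] used below must be nonnegative. *)
Lemma le_of_quadratic (X Y C : R) :
  (forall r, 0 < r -> r <= 1 -> r * X <= r ^+ 2 * C + r * Y) -> X <= Y.
Proof.
move=> H; apply/ler_addgt0Pr => e e0.
pose r := Num.min 1 (e / (`|C| + 1)).
have C1 : 0 < `|C| + 1 by rewrite ltr_wpDl.
have r0 : 0 < r by rewrite lt_min ltr01 divr_gt0.
have r1 : r <= 1 by rewrite ge_min lexx.
have rC : r * C <= e.
  apply: (@le_trans _ _ (r * (`|C| + 1))).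
    by rewrite ler_pM2l// (le_trans (ler_norm C))// lerDl.
  by rewrite -ler_pdivlMr// ge_min lexx orbT.
have := H r r0 r1; rewrite expr2 -mulrA -mulrDr ler_pM2l//; lra.
Qed.

Variables (a b : R) (f alpha u : R -> R) (K : R).
Variables Df Du : {charge set (measurableTypeR R) -> \bar R}.
Hypotheses (ltab : a < b) (bf : BV_deriv a b f Df)
  (malpha : measurable_fun `]a, b[ alpha)
  (alpha0 : forall t, `]a, b[%classic t -> 0 <= alpha t)
  (alphaK : forall t, `]a, b[%classic t -> `|alpha t| <= K)
  (solu : tv_solution a b f alpha u Du).

Let g t := f t - u t.
Let G := tail_integral b g.
Let pos := charge_pos_variation Du.
Let neg := charge_neg_variation Du.

Let bu : BV_deriv a b u Du. Proof. by case: solu. Qed.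

Lemma residual_integrable : mu.-integrable `]a, b[ (EFin \o g).
Proof. by apply: integrable_sub => //; [case: bf|case: bu]. Qed.

Let ig2 : mu.-integrable `]a, b[ (EFin \o (fun t => g t ^+ 2)).
Proof.
have [M1 H1] := BV_deriv_ae_bounded ltab bf.
have [M2 H2] := BV_deriv_ae_bounded ltab bu.
apply: (@square_integrable _ _ _ _ (M1 + M2) residual_integrable).
apply: (@filterS2 _ _ (ae_filter_ringOfSetsType mu) _ _ _ _ H1 H2) => t h1 h2 tab.
by rewrite (le_trans (ler_normB _ _))// lerD ?h1 ?h2.
Qed.

Let cpos : concentrated a b pos.
Proof. by apply: charge_pos_concentrated; case: bu. Qed.

Let cneg : concentrated a b neg.
Proof. by apply: charge_neg_concentrated; case: bu. Qed.

Let dpu : deriv_pair a b u pos neg. Proof. exact: BV_deriv_pair. Qed.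

Let iu : mu.-integrable `]a, b[ (EFin \o u). Proof. by case: bu. Qed.

Let I m := \int[m]_(t in `]a, b[) alpha t.

(** The first variation in the direction [mass k a], with the linear term turned into an integral of
    [G] against [k] by [integral_mass]. *)
Let perturb k r m n : concentrated a b m -> concentrated a b n ->
  (forall phi, test_function a b phi ->
    \int[m]_(t in `]a, b[) phi t - \int[n]_(t in `]a, b[) phi t =
    \int[pos]_(t in `]a, b[) phi t - \int[neg]_(t in `]a, b[) phi t +
    r * \int[k]_(t in `]a, b[) phi t) ->
  I pos + I neg + r * \int[k]_(t in `]a, b[) G t <=
  r ^+ 2 * (2^-1 * \int[mu]_(t in `]a, b[) mass k a t ^+ 2) + (I m + I n).
Proof.
move=> cm cn E.
rewrite -(integral_mass k residual_integrable).
apply: (tv_solution_first_variation malpha alpha0 alphaK solu residual_integrable ig2) => //.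
- exact: measurable_mass.
- exact: mass_bounded.
- exact: deriv_pair_add E.
Qed.

Let I_addscale m n (r : {nonneg R}) : I (addscale m n r) = I m + r%:num * I n.
Proof. exact: (Rintegral_addscale m n r (measurable_itv _) malpha alphaK). Qed.

Let I_mscale m (r : {nonneg R}) : I (mscale r m) = r%:num * I m.
Proof. exact: (Rintegral_mscale m r (measurable_itv _) malpha alphaK). Qed.

Let I_dirac p : p \in `]a, b[ -> I (delta p) = alpha p.
Proof. by move=> pab; exact: Rintegral_dirac. Qed.

Let test_addscale m n (r : {nonneg R}) phi : test_function a b phi ->
  \int[addscale m n r]_(t in `]a, b[) phi t =
  \int[m]_(t in `]a, b[) phi t + r%:num * \int[n]_(t in `]a, b[) phi t.
Proof.
move=> tphi; have [M phiM] := test_function_bounded tphi.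
apply: (@Rintegral_addscale _ _ _ _ _ _ _ _ M) => //.
exact: test_function_measurable tphi.
Qed.

Let test_mscale m (r : {nonneg R}) phi : test_function a b phi ->
  \int[mscale r m]_(t in `]a, b[) phi t = r%:num * \int[m]_(t in `]a, b[) phi t.
Proof.
move=> tphi; have [M phiM] := test_function_bounded tphi.
apply: (@Rintegral_mscale _ _ _ _ _ _ _ M) => //.
exact: test_function_measurable tphi.
Qed.

(** Adding a jump of size [r] at [p] raises the variation term by at most [r * alpha p] and changes
    the fidelity term by [- r * G p] to first order. An upward jump is charged to the positive part,
    a downward one to the negative part. *)
Lemma optimality_bound p : p \in `]a, b[ -> `|G p| <= alpha p.
Proof.
move=> pab.
have GE : \int[(delta p)]_(t in `]a, b[) G t = G p.
  by apply: Rintegral_dirac => //; exact: measurable_tail_integral residual_integrable.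
have cd := dirac_concentrated pab.
rewrite ler_norml lerNl; apply/andP; split; apply: le_of_quadratic => r r0 _;
  pose s : {nonneg R} := NngNum (ltW r0).
- have H := @perturb (delta p) (- r) pos (addscale neg (delta p) s)
    cpos (addscale_concentrated s cneg cd).
  rewrite I_addscale I_dirac// GE sqrrN in H.
  have arith (X Y Z C V : R) : X + Y + - r * Z <= r ^+ 2 * C + (X + (Y + r * V)) ->
    r * - Z <= r ^+ 2 * C + r * V by lra.
  apply: (arith _ _ _ _ _ (H _)) => phi tphi.
  by rewrite test_addscale// opprD addrA mulNr.
- have H := @perturb (delta p) r (addscale pos (delta p) s) neg
    (addscale_concentrated s cpos cd) cneg.
  rewrite I_addscale I_dirac// GE in H.
  have arith (X Y Z C V : R) : X + Y + r * Z <= r ^+ 2 * C + (X + r * V + Y) ->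
    r * Z <= r ^+ 2 * C + r * V by lra.
  apply: (arith _ _ _ _ _ (H _)) => phi tphi.
  by rewrite test_addscale// addrAC.
Qed.

(** Subtracting [r * mass pos a] from [u] scales the positive part by [1 - r]. Combined with
    [G <= alpha], the inequality forces [G = alpha] almost everywhere for [pos]. *)
Lemma optimality_pos : I pos <= \int[pos]_(t in `]a, b[) G t.
Proof.
apply: le_of_quadratic => r r0 r1.
have r1' : 0 <= 1 - r by rewrite subr_ge0.
pose s : {nonneg R} := NngNum r1'.
have H := @perturb pos (- r) (mscale s pos) neg (mscale_concentrated s cpos) cneg.
rewrite I_mscale sqrrN in H.
have arith (X Y Z C : R) : X + Y + - r * Z <= r ^+ 2 * C + ((1 - r) * X + Y) ->
  r * X <= r ^+ 2 * C + r * Z by lra.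
apply: (arith _ _ _ _ (H _)) => phi tphi.
by rewrite test_mscale//= mulrBl mul1r mulNr addrAC.
Qed.

Lemma optimality_neg : I neg <= - \int[neg]_(t in `]a, b[) G t.
Proof.
apply: le_of_quadratic => r r0 r1.
have r1' : 0 <= 1 - r by rewrite subr_ge0.
pose s : {nonneg R} := NngNum r1'.
have H := @perturb neg r pos (mscale s neg) cpos (mscale_concentrated s cneg).
rewrite I_mscale in H.
have arith (X Y Z C : R) : X + Y + r * Z <= r ^+ 2 * C + (X + (1 - r) * Y) ->
  r * Y <= r ^+ 2 * C + r * - Z by lra.
apply: (arith _ _ _ _ (H _)) => phi tphi.
by rewrite test_mscale//= mulrBl mul1r opprB addrCA addrC.
Qed.

End optimality.

(** * One-sided limits and kinks *)

Section local_analysis.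
Context {R : realType}.
Notation mu := (@lebesgue_measure R).
Implicit Types (a b c e p q s t x y : R) (f g h z : R -> R).
Implicit Types m : {finite_measure set (measurableTypeR R) -> \bar R}.

Lemma near_itv_subset y (P : R -> Prop) : (\forall t \near y, P t) ->
  exists2 e : R, 0 < e & forall t, y - e < t < y + e -> P t.
Proof.
move=> [e /= e0 He]; exists e => // t /andP[yt ty]; apply: He.
by rewrite /ball_/= ltr_norml; lra.
Qed.

(** By continuity [h] exceeds [h y / 2] on an interval around [y], so [h y / 2] times the mass of
    that interval is at most the integral of [h], which is nonpositive. *)
Lemma contact_measure0 a b m h (K : R) y : measurable_fun `]a, b[ h ->
  (forall t, `]a, b[%classic t -> 0 <= h t) ->
  (forall t, `]a, b[%classic t -> `|h t| <= K) ->
  \int[m]_(t in `]a, b[) h t <= 0 ->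
  y \in `]a, b[ -> {for y, continuous h} -> 0 < h y ->
  exists2 e : R, 0 < e & (`]y - e, y + e[ `<=` `]a, b[) /\ m `]y - e, y + e[%classic = 0%E.
Proof.
move=> mh h0 hK Ih yab ch hy.
have hy2 : h y / 2 < h y by lra.
have [e e0 He] : exists2 e : R, 0 < e & forall t, y - e < t < y + e ->
    (t \in `]a, b[) /\ h y / 2 < h t.
  apply: near_itv_subset; apply: filterI; first exact: near_in_itvoo.
  exact: (cvgr_gt (h y) ch).
exists e => //; have eab : `]y - e, y + e[ `<=` `]a, b[.
  by move=> t /=; rewrite in_itv/= => /He[].
split=> //.
have ih := bounded_fun_integrable m (measurable_itv _) mh hK.
set J := `]y - e, y + e[%classic in eab *.
have mJ : measurable (J : set (measurableTypeR R)) by exact: measurable_itv.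
have : (\int[m]_(t in J) (h y / 2)%:E <= 0)%E.
  apply: (@le_trans _ _ (\int[m]_(t in `]a, b[) (h t)%:E)%E); last first.
    by rewrite (EFin_Rintegral _ ih)// lee_fin.
  apply: (@le_trans _ _ (\int[m]_(t in J) (h t)%:E)%E).
    apply: ge0_le_integral => //.
    - by move=> t _; rewrite lee_fin; lra.
    - by apply/measurable_EFinP; exact: measurable_funS mh.
    - by move=> t; rewrite /J/= in_itv/= => /He[_ /ltW]; rewrite lee_fin.
  apply: ge0_subset_integral => //.
  by apply/measurable_EFinP.
rewrite integral_cst//= => H; apply/eqP; rewrite eq_le measure_ge0 andbT.
by move: H; rewrite pmule_rle0// lte_fin; lra.
Qed.

(** Dominated convergence, because the sequences that characterize one-sided limits are not assumed
    monotone and continuity of [m] along monotone sets would not apply. *)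
Lemma mass_indic_cvg m a (A : set R) (t_ : nat -> R) : measurable A ->
  (forall s, (\1_`]a, t_ n] s : R) @[n --> \oo] --> (\1_A s : R)) ->
  mass m a (t_ n) @[n --> \oo] --> fine (m A).
Proof.
move=> mA cA.
have mi (B : set R) : measurable B ->
    measurable_fun [set: measurableTypeR R] (fun s => (\1_B s : R)%:E).
  by move=> mB; apply/measurable_EFinP; exact: measurable_indic.
have E (B : set R) : measurable B -> (\int[m]_s (\1_B s : R)%:E = m B)%E.
  by move=> mB; rewrite integral_indic// setIT.
have [||||_ _ H] := @dominated_convergence _ _ _ m setT measurableT
  (fun n s => (\1_`]a, t_ n] s)%:E) (fun s => (\1_A s)%:E) (EFin \o cst 1) _ (mi _ mA).
- by move=> n; exact: mi.
- by apply: aeW => s _; apply: cvg_EFin; [exact: nearW|exact: cA].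
- exact: finite_measure_integrable_cst.
- apply: aeW => s n _; rewrite abse_EFin lee_fin ger0_norm ?indic_ge0// indicE.
  by case: (_ \in _).
rewrite (E A mA) in H.
apply: fine_cvg; rewrite fineK ?fin_num_measure//.
by move: H; apply: cvg_trans; apply: near_eq_cvg; near=> n; rewrite /= E//.
Unshelve. all: by end_near. Qed.

Lemma mass_right_cvg m a x : a < x -> mass m a t @[t --> x^'+] --> mass m a x.
Proof.
move=> ax; apply/cvg_at_rightP => t_ [tx tcvg].
apply: mass_indic_cvg => // s; apply: cvg_near_cst.
have [sx|xs] := leP s x.
  near=> n; rewrite !indicE !mem_setE !in_itv/= sx (le_trans sx (ltW (tx n)))//.
near=> n; rewrite !indicE !mem_setE !in_itv/= [s <= x]leNgt xs.
suff -> : (s <= t_ n) = false by [].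
apply/negbTE; rewrite -ltNge; near: n.
exact: (cvgr_lt x tcvg).
Unshelve. all: by end_near. Qed.

Lemma mass_left_cvg m a x : a < x ->
  mass m a t @[t --> x^'-] --> mass m a x - fine (m [set x]).
Proof.
move=> ax.
have -> : mass m a x - fine (m [set x]) = fine (m `]a, x[%classic).
  rewrite /mass; have -> : `]a, x]%classic = `]a, x[ `|` [set x] :> set R by rewrite setUitv1.
  rewrite measureU//; last first.
    by rewrite -subset0 => t [/= + tx]; rewrite in_itv/= tx ltxx andbF.
  by rewrite fineD ?fin_num_measure// addrK.
apply/cvg_at_leftP => t_ [tx tcvg].
apply: mass_indic_cvg => // s; apply: cvg_near_cst.
have [sx|xs] := ltP s x.
  near=> n; rewrite !indicE !mem_setE !in_itv/= sx.
  suff -> : s <= t_ n by [].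
  by apply: ltW; near: n; exact: (cvgr_gt x tcvg).
near=> n; rewrite !indicE !mem_setE !in_itv/= [s < x]ltNge xs.
suff -> : (s <= t_ n) = false by [].
by apply/negbTE; rewrite -ltNge (lt_le_trans (tx n)).
Unshelve. all: by end_near. Qed.

Lemma Rintegral_ae_le p q g e : p <= q -> mu.-integrable `]p, q[ (EFin \o g) -> 0 <= e ->
  {ae mu, forall t, t \in `]p, q[ -> `|g t| <= e} ->
  `|\int[mu]_(t in `]p, q[) g t| <= e * (q - p).
Proof.
move=> pq ig e0 aeg; apply: (le_trans (le_normr_Rintegral _ ig)) => //.
rewrite -lee_fin -EFin_Rintegral//; last exact: (integrable_abse ig).
apply: (@le_trans _ _ (\int[mu]_(t in `]p, q[) e%:E)%E).
  apply: ae_ge0_le_integral => //.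
  apply/measurable_EFinP; apply: measurableT_comp => //.
  by apply/measurable_EFinP; exact: measurable_int ig.
rewrite integral_cst//= lebesgue_measure_itv/= lte_fin.
case: ltP => [_|qp]; first by rewrite -EFinD -EFinM.
by rewrite mule0 lee_fin mulr_ge0// subr_ge0.
Qed.

(** * One-sided slopes of a primitive *)

Section kink.
Variables (a b x : R) (Phi z Z : R -> R).
Hypotheses (xab : x \in `]a, b[) (iz : mu.-integrable `]a, b[ (EFin \o z))
  (PhiE : forall p q, a < p -> p <= q -> q < b ->
     Phi q - Phi p = \int[mu]_(t in `]p, q]) z t)
  (zZ : {ae mu, forall t, t \in `]a, b[ -> z t = Z t}).

(** [Phi] is a primitive of [z], and hence of its representative [Z]. One-sided limits of [Z] at a
    point thus become one-sided slopes of [Phi] there. *)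
Lemma slope_bound p q c e : a < p -> p <= q -> q < b -> 0 <= e ->
  (forall t, p < t < q -> `|Z t - c| <= e) ->
  `|Phi q - Phi p - c * (q - p)| <= e * (q - p).
Proof.
move=> ap pq qb e0 Zc.
have sub : `]p, q[ `<=` `]a, b[.
  by move=> t /=; rewrite !in_itv/= => /andP[pt tq]; rewrite (lt_trans ap pt) (lt_trans tq qb).
have izs : mu.-integrable `]p, q[ (EFin \o z) by exact: integrableS iz.
have ic : mu.-integrable `]p, q[ (EFin \o (cst c)).
  by apply: continuous_integrable_itv; exact: cst_continuous.
have -> : Phi q - Phi p - c * (q - p) = \int[mu]_(t in `]p, q[) (z t - c).
  rewrite RintegralB// PhiE// Rintegral_itv_bndo_bndc//; congr (_ - _).
  rewrite Rintegral_cst//= lebesgue_measure_itv/= lte_fin.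
  case: ltP => [_|qp]; first by rewrite -EFinD.
  by have -> : q = p; [apply/eqP; rewrite eq_le qp pq|rewrite subrr mulr0].
apply: Rintegral_ae_le => //; first exact: integrable_sub.
apply: (@filterS _ _ (ae_filter_ringOfSetsType mu) _ _ _ zZ) => t h tpq.
by rewrite h; [move: tpq; rewrite in_itv; exact: Zc|exact: sub].
Qed.

Lemma slope_right (Zr : R) e : Z t @[t --> x^'+] --> Zr -> 0 < e ->
  \forall t \near x^'+, `|Phi t - Phi x - Zr * (t - x)| <= e * (t - x).
Proof.
move=> ZZr e0; move: xab; rewrite in_itv/= => /andP[ax xb].
move/cvgrPdist_le : ZZr => /(_ e e0) [d /= d0 Hd].
near=> t; have xt : x < t by [].
have tb : t < b by near: t; exact: nbhs_right_lt.
apply: (slope_bound ax (ltW xt) tb (ltW e0)) => s /andP[xs st].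
rewrite distrC; apply: Hd => //=; rewrite ltr_norml.
have : t < x + d by near: t; apply: nbhs_right_lt; rewrite ltrDl.
lra.
Unshelve. all: by end_near. Qed.

Lemma slope_left (Zl : R) e : Z t @[t --> x^'-] --> Zl -> 0 < e ->
  \forall t \near x^'-, `|Phi x - Phi t - Zl * (x - t)| <= e * (x - t).
Proof.
move=> ZZl e0; move: xab; rewrite in_itv/= => /andP[ax xb].
move/cvgrPdist_le : ZZl => /(_ e e0) [d /= d0 Hd].
near=> t; have tx : t < x by [].
have at_ : a < t by near: t; exact: nbhs_left_gt.
apply: (slope_bound at_ (ltW tx) xb (ltW e0)) => s /andP[ts sx].
rewrite distrC; apply: Hd => //=; rewrite ltr_norml.
have : x - d < t by near: t; apply: nbhs_left_gt; rewrite ltrBlDr ltrDl.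
lra.
Unshelve. all: by end_near. Qed.

Variables (Zl Zr : R).
Hypotheses (ZZl : Z t @[t --> x^'-] --> Zl) (ZZr : Z t @[t --> x^'+] --> Zr).

(** At a minimum the left slope is nonpositive and the right slope nonnegative; both are shown up to
    an arbitrary [e]. *)
Lemma kink_min : (\forall t \near x, Phi x <= Phi t) -> Zl <= Zr.
Proof.
move=> minx; apply: (@le_trans _ _ 0).
  apply/ler_addgt0Pr => e e0; rewrite add0r.
  near (at_left x) => t.
  have tx : t < x by [].
  have h1 : Phi x <= Phi t by near: t; apply: cvg_at_left_filter minx; exact: cvg_id.
  have : `|Phi x - Phi t - Zl * (x - t)| <= e * (x - t) by near: t; exact: slope_left.
  rewrite ler_norml => /andP[h2 _].
  have xt : 0 < x - t by rewrite subr_gt0.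
  rewrite -(ler_pM2r xt); lra.
apply/ler_addgt0Pr => e e0.
near (at_right x) => t.
have tx : x < t by [].
have h1 : Phi x <= Phi t by near: t; apply: cvg_at_right_filter minx; exact: cvg_id.
have : `|Phi t - Phi x - Zr * (t - x)| <= e * (t - x) by near: t; exact: slope_right.
rewrite ler_norml => /andP[_ h2].
have xt : 0 < t - x by rewrite subr_gt0.
rewrite -(ler_pM2r xt); lra.
Unshelve. all: by end_near. Qed.

Lemma kink_flat : (\forall t \near x, Phi t = Phi x) -> Zl = Zr.
Proof.
move=> flat; have Zl0 : Zl = 0.
  apply/eqP; rewrite -normr_eq0 eq_le normr_ge0 andbT; apply/ler_addgt0Pr => e e0; rewrite add0r.
  near (at_left x) => t.
  have tx : t < x by [].
  have h1 : Phi t = Phi x by near: t; apply: cvg_at_left_filter flat; exact: cvg_id.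
  have : `|Phi x - Phi t - Zl * (x - t)| <= e * (x - t) by near: t; exact: slope_left.
  have xt : 0 < x - t by rewrite subr_gt0.
  by rewrite h1 subrr sub0r normrN normrM (gtr0_norm xt) ler_pM2r.
rewrite Zl0; apply/esym/eqP; rewrite -normr_eq0 eq_le normr_ge0 andbT.
apply/ler_addgt0Pr => e e0; rewrite add0r.
near (at_right x) => t.
have tx : x < t by [].
have h1 : Phi t = Phi x by near: t; apply: cvg_at_right_filter flat; exact: cvg_id.
have : `|Phi t - Phi x - Zr * (t - x)| <= e * (t - x) by near: t; exact: slope_right.
have xt : 0 < t - x by rewrite subr_gt0.
by rewrite h1 subrr sub0r normrN normrM (gtr0_norm xt) ler_pM2r.
Unshelve. all: by end_near. Qed.

End kink.

(** Continuity makes every point of []a, b[] a Lebesgue point of [alpha], so testing with windows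
    gives the increment between all pairs of points, with no exceptional null set. *)
Lemma weak_derivative_increment a b (alpha dalpha : R -> R) p q :
  {within `[a, b], continuous alpha} -> weak_derivative a b alpha dalpha ->
  mu.-integrable `]a, b[ (EFin \o dalpha) -> a < p -> p <= q -> q < b ->
  alpha q - alpha p = \int[mu]_(t in `]p, q]) dalpha t.
Proof.
move=> ca wd id ap pq qb.
have ltab : a < b := lt_trans ap (le_lt_trans pq qb).
have ia : mu.-integrable `]a, b[ (EFin \o alpha).
  apply: (@integrableS _ _ _ mu `[a, b]) => //; first exact: subset_itv_oo_cc.
  by apply: continuous_compact_integrable => //; exact: segment_compact.
have lp s : s \in `]a, b[ -> lebesgue_pt (alpha \_ `]a, b[) s.
  move=> sab; apply: (@continuous_lebesgue_pt _ _ _ `]a, b[).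
  - by split; [exact: itv_open|].
  - exact: measurable_itv.
  - apply: measurable_funTS; apply/(measurable_restrictT _ _).1 => //.
    by apply/measurable_EFinP; exact: measurable_int ia.
  - have cs := within_continuous_continuous ltab ca sab.
    rewrite /prop_for /continuous_at patchE mem_set//.
    move: cs; apply: cvg_trans; apply: near_eq_cvg; near=> t.
    by rewrite patchE mem_set//=; near: t; exact: near_in_itvoo.
have pab : p \in `]a, b[ by rewrite in_itv/= ap (le_lt_trans pq qb).
have qab : q \in `]a, b[ by rewrite in_itv/= qb (lt_le_trans ap pq).
have H1 := cvg_integral_window pab qab ia (lp _ pab) (lp _ qab).
have H2 := window_dominated_cvg pq ap qb id.
have H3 :
    (- \int[mu]_(t in `]a, b[) (dalpha t * window h p q t)) @[h --> 0^'+] --> alpha p - alpha q.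
  move: H1; apply: cvg_trans; apply: near_eq_cvg; near=> h.
  rewrite wd//; apply: window_test_function => //.
  by rewrite -ltrBrDl; near: h; apply: nbhs_right_lt; rewrite subr_gt0.
have E : alpha p - alpha q = - \int[mu]_(t in `]p, q]) dalpha t.
  exact: cvg_unique H3 (cvgN H2).
by rewrite -(opprB (alpha p)) E opprK.
Unshelve. all: by end_near. Qed.

End local_analysis.

(** * Necessary conditions *)

Section necessary_conditions.
Context {R : realType}.
Notation mu := (@lebesgue_measure R).
Implicit Types (e p q s t y : R).

Lemma measure0_subset (m : {finite_measure set (measurableTypeR R) -> \bar R})
    (A B : set (measurableTypeR R)) : measurable A -> measurable B -> A `<=` B ->
  m B = 0%E -> m A = 0%E.
Proof. by move=> mA mB AB mB0; exact: (subset_measure0 mA mB AB mB0). Qed.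

Lemma continuous_itv_data (a b : R) (alpha : R -> R) : {within `[a, b], continuous alpha} ->
  (forall t, t \in `[a, b] -> 0 < alpha t) ->
  [/\ measurable_fun `]a, b[ alpha, forall t, `]a, b[%classic t -> 0 <= alpha t &
    exists K : R, forall t, `]a, b[%classic t -> `|alpha t| <= K].
Proof.
move=> ca a0; split.
- apply: (@measurable_funS _ _ _ _ `[a, b]) => //; first exact: subset_itv_oo_cc.
  exact: subspace_continuous_measurable_fun.
- by move=> t tab; apply/ltW/a0; exact: subset_itv_oo_cc.
- have [K HK] := continuous_bounded_itv ca.
  by exists K => t /=; rewrite in_itv/= => /andP[at_ tb]; rewrite HK// !ltW.
Qed.

Variables (a b x : R) (f alpha dalpha u : R -> R).
Variables Df Ddalpha Du : {charge set (measurableTypeR R) -> \bar R}.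
Hypotheses (xab : x \in `]a, b[) (data : tv_data a b x f Df alpha dalpha Ddalpha)
  (solu : tv_solution a b f alpha u Du).

Let ltab : a < b.
Proof. by move: xab; rewrite in_itv/= => /andP[ax]; exact: lt_trans. Qed.

Let ax : a < x. Proof. by move: xab; rewrite in_itv/= => /andP[]. Qed.

Let bf : BV_deriv a b f Df. Proof. by case: data => [] []. Qed.

Let ca : {within `[a, b], continuous alpha}. Proof. by case: data. Qed.

Let apos t : t \in `]a, b[ -> 0 < alpha t.
Proof. by move=> tab; case: data => _ _ a0 _ _; apply: a0; exact: subset_itv_oo_cc. Qed.

Let bda : BV_deriv a b dalpha Ddalpha. Proof. by case: data => _ _ _ []. Qed.

Let g t := f t - u t.
Let G := tail_integral b g.
Let pos := charge_pos_variation Du.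
Let neg := charge_neg_variation Du.
Let atom (nu : {charge set (measurableTypeR R) -> \bar R}) := fine (nu [set x]).

Let ig : mu.-integrable `]a, b[ (EFin \o g).
Proof. exact: (residual_integrable bf solu). Qed.

Let alpha_data : [/\ measurable_fun `]a, b[ alpha,
  forall t, `]a, b[%classic t -> 0 <= alpha t &
  exists K : R, forall t, `]a, b[%classic t -> `|alpha t| <= K].
Proof. by apply: continuous_itv_data => //; case: data. Qed.

Let G_le t : t \in `]a, b[ -> `|G t| <= alpha t.
Proof.
have [ma a0 [K aK]] := alpha_data.
exact: (optimality_bound ltab bf ma a0 aK solu).
Qed.

Let alpha_continuous t : t \in `]a, b[ -> {for t, continuous alpha}.
Proof. by move=> tab; exact: (within_continuous_continuous ltab ca tab). Qed.

Let G_continuous t : t \in `]a, b[ -> {for t, continuous G}.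
Proof. by move=> tab; exact: (tail_integral_continuous tab ig). Qed.

(* [s = 1] and [s = -1] single out the positive and the negative part of [Du]. *)
Let off_contact (m : {finite_measure set (measurableTypeR R) -> \bar R}) (s : R) y :
  (s = 1 \/ s = -1) ->
  \int[m]_(t in `]a, b[) alpha t <= s * \int[m]_(t in `]a, b[) G t ->
  y \in `]a, b[ -> s * G y < alpha y ->
  exists2 e : R, 0 < e & (`]y - e, y + e[ `<=` `]a, b[) /\ m `]y - e, y + e[%classic = 0%E.
Proof.
move=> s1 Im yab Gy; have [ma a0 [K aK]] := alpha_data.
have sn : `|s| = 1 by case: s1 => ->; rewrite ?normrN normr1.
have sG t : t \in `]a, b[ -> `|s * G t| <= alpha t.
  by move=> tab; rewrite normrM sn mul1r G_le.
have mG : measurable_fun `]a, b[ G by exact: measurable_tail_integral.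
have msG : measurable_fun `]a, b[ (fun t => s * G t) by exact: measurable_funM.
have sGK t : `]a, b[%classic t -> `|s * G t| <= K.
  by move=> tab; rewrite (le_trans (sG t tab))// (le_trans (ler_norm _))// aK.
have isG := bounded_fun_integrable m (measurable_itv _) msG sGK.
have GK t : `]a, b[%classic t -> `|G t| <= K.
  by move=> tab; rewrite -[`|G t|]mul1r -sn -normrM sGK.
have iG := bounded_fun_integrable m (measurable_itv _) mG GK.
have ia := bounded_fun_integrable m (measurable_itv _) ma aK.
apply: (@contact_measure0 _ a b m (fun t => alpha t - s * G t) (K + K)) => //.
- exact: measurable_funB.
- by move=> t tab; rewrite subr_ge0 (le_trans (ler_norm _))// sG.
- by move=> t tab; rewrite (le_trans (ler_normB _ _))// lerD ?aK ?sGK.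
- by rewrite RintegralB// RintegralZl// subr_le0.
- apply: cvgB; first exact: alpha_continuous.
  by apply: cvgMr; exact: G_continuous.
- by rewrite subr_gt0.
Qed.

Let off_contact_pos y : y \in `]a, b[ -> G y < alpha y ->
  exists2 e : R, 0 < e & (`]y - e, y + e[ `<=` `]a, b[) /\ pos `]y - e, y + e[%classic = 0%E.
Proof.
move=> yab Gy; have [ma a0 [K aK]] := alpha_data.
apply: (@off_contact pos 1) => //; rewrite ?mul1r//; first by left.
exact: (optimality_pos ltab bf ma a0 aK solu).
Qed.

Let off_contact_neg y : y \in `]a, b[ -> - G y < alpha y ->
  exists2 e : R, 0 < e & (`]y - e, y + e[ `<=` `]a, b[) /\ neg `]y - e, y + e[%classic = 0%E.
Proof.
move=> yab Gy; have [ma a0 [K aK]] := alpha_data.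
apply: (@off_contact neg (-1)) => //; rewrite ?mulN1r//; first by right.
exact: (optimality_neg ltab bf ma a0 aK solu).
Qed.

Let off_support y : y \in `]a, b[ -> G y < alpha y -> - G y < alpha y ->
  exists2 e : R, 0 < e & (`]y - e, y + e[ `<=` `]a, b[) /\
    charge_total_variation Du `]y - e, y + e[%classic = 0%E.
Proof.
move=> yab Gy Gy'; have [e1 e10 [s1 p1]] := off_contact_pos yab Gy.
have [e2 e20 [s2 p2]] := off_contact_neg yab Gy'.
pose e := Num.min e1 e2.
have i1 : `]y - e, y + e[ `<=` `]y - e1, y + e1[.
  by apply: subset_itv; rewrite bnd_simp ?lerD2l ?lerN2 ge_min lexx.
have i2 : `]y - e, y + e[ `<=` `]y - e2, y + e2[.
  by apply: subset_itv; rewrite bnd_simp ?lerD2l ?lerN2 ge_min lexx orbT.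
exists e; first by rewrite lt_min e10.
split; first exact: subset_trans i1 s1.
rewrite charge_total_variationE -/pos -/neg.
by rewrite (measure0_subset _ _ i1 p1)// (measure0_subset _ _ i2 p2)// adde0.
Qed.

Let pos_atom0 : G x < alpha x -> pos [set x] = 0%E.
Proof.
move=> /(off_contact_pos xab)[e e0 [_ p0]]; apply: measure0_subset p0 => //.
by move=> t ->; rewrite /= in_itv/=; apply/andP; split; lra.
Qed.

Let neg_atom0 : - G x < alpha x -> neg [set x] = 0%E.
Proof.
move=> /(off_contact_neg xab)[e e0 [_ p0]]; apply: measure0_subset p0 => //.
by move=> t ->; rewrite /= in_itv/=; apply/andP; split; lra.
Qed.

Let Du_atom : atom Du = fine (pos [set x]) - fine (neg [set x]).
Proof. by rewrite /atom charge_decomp// fineB ?fin_num_measure. Qed.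

Let atom_E (nu : {charge set (measurableTypeR R) -> \bar R}) : nu [set x] = (atom nu)%:E.
Proof. by rewrite /atom fineK// fin_num_measure. Qed.

Let Df_atom : atom Df = 0.
Proof.
have : charge_total_variation Df [set x] = 0%E by case: data => [] [].
rewrite charge_total_variationE /atom charge_decomp// fineB ?fin_num_measure//.
move=> /eqP; rewrite padde_eq0 ?measure_ge0// => /andP[/eqP -> /eqP ->].
by rewrite subrr.
Qed.

(** Since [G] has derivative [- g], the function [alpha - s * G] is a primitive of [dalpha + s * g].
    Its representative jumps at [x] by [Ddalpha {x} + s * (Df {x} - Du {x})], and [Df {x} = 0]. *)
Let kink_data (s : R) : exists z Z, [/\ mu.-integrable `]a, b[ (EFin \o z),
  forall p q, a < p -> p <= q -> q < b ->
     (alpha q - s * G q) - (alpha p - s * G p) = \int[mu]_(t in `]p, q]) z t,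
  {ae mu, forall t, t \in `]a, b[ -> z t = Z t} &
  exists2 l, Z t @[t --> x^'-] --> l &
    Z t @[t --> x^'+] --> l + (atom Ddalpha - s * atom Du)].
Proof.
have ida : mu.-integrable `]a, b[ (EFin \o dalpha) by case: bda.
have wd : weak_derivative a b alpha dalpha by case: data => _ _ _ [].
have [c1 ae1] := BV_deriv_ae ltab bda.
have [c2 ae2] := BV_deriv_ae ltab bf.
have [c3 ae3] := BV_deriv_ae ltab (proj1 solu).
pose M (nu : {charge set (measurableTypeR R) -> \bar R}) t :=
  mass (charge_pos_variation nu) a t - mass (charge_neg_variation nu) a t.
pose Z t := c1 + M Ddalpha t + s * ((c2 + M Df t) - (c3 + M Du t)).
have isg : mu.-integrable `]a, b[ (EFin \o (fun t => s * g t)) by exact: integrable_scale.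
have Mr nu : M nu t @[t --> x^'+] --> M nu x.
  by apply: cvgB; exact: mass_right_cvg.
have Ml nu : M nu t @[t --> x^'-] --> M nu x - atom nu.
  rewrite (_ : _ - _ =
    (mass (charge_pos_variation nu) a x - fine (charge_pos_variation nu [set x])) -
    (mass (charge_neg_variation nu) a x - fine (charge_neg_variation nu [set x]))).
    by apply: cvgB; exact: mass_left_cvg.
  rewrite /atom charge_decomp// fineB ?fin_num_measure// /M; lra.
have Hr c (nu : {charge set (measurableTypeR R) -> \bar R}) :
    c + M nu t @[t --> x^'+] --> c + M nu x.
  by apply: cvgD; [exact: cvg_cst|exact: Mr].
have Hl c (nu : {charge set (measurableTypeR R) -> \bar R}) :
    c + M nu t @[t --> x^'-] --> c + (M nu x - atom nu).
  by apply: cvgD; [exact: cvg_cst|exact: Ml].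
exists (fun t => dalpha t + s * g t), Z; split.
- exact: integrable_add.
- move=> p q ap pq qb.
  have sub : `]p, q] `<=` `]a, b[.
    by move=> t /=; rewrite !in_itv/= => /andP[pt tq]; rewrite (lt_trans ap pt) (le_lt_trans tq qb).
  rewrite RintegralD//; [|exact: integrableS ida|exact: integrableS isg].
  rewrite RintegralZl//; last exact: integrableS ig.
  rewrite -(weak_derivative_increment ca wd ida ap pq qb).
  rewrite -(tail_integralB ap pq qb ig) -/G; lra.
- have := @filterS3 _ _ (ae_filter_ringOfSetsType mu) _ _ _ _ _ ae1 ae2 ae3.
  by apply => t h1 h2 h3 tab; rewrite /g h1// h2// h3.
(* Each [M nu] is right-continuous with left limit [M nu x - atom nu], so the right limit of [Z] is
   [Z x] and [l] is obtained by removing the atoms. *)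
- pose l := c1 + (M Ddalpha x - atom Ddalpha) +
    s * ((c2 + (M Df x - atom Df)) - (c3 + (M Du x - atom Du))).
  exists l.
    by apply: cvgD; [exact: Hl|apply: cvgMr; apply: cvgB; exact: Hl].
  have -> : l + (atom Ddalpha - s * atom Du) = Z x.
    by rewrite /l /Z Df_atom; ring.
  by apply: cvgD; [exact: Hr|apply: cvgMr; apply: cvgB; exact: Hr].
Qed.

Let kink_le (s : R) : (\forall t \near x, alpha x - s * G x <= alpha t - s * G t) ->
  s * atom Du <= atom Ddalpha.
Proof.
move=> minx; have [z [Z [iz PhiE zZ [l Zl Zr]]]] := kink_data s.
have := kink_min xab iz PhiE zZ Zl Zr minx; lra.
Qed.

Let kink_eq (s : R) : (\forall t \near x, alpha t - s * G t = alpha x - s * G x) ->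
  s * atom Du = atom Ddalpha.
Proof.
move=> flat; have [z [Z [iz PhiE zZ [l Zl Zr]]]] := kink_data s.
have := kink_flat xab iz PhiE zZ Zl Zr flat; lra.
Qed.

Let near_xab : \forall t \near x, t \in `]a, b[.
Proof. exact: near_in_itvoo. Qed.

Let contact_le_pos : G x = alpha x -> atom Du <= atom Ddalpha.
Proof.
move=> Gx; rewrite -[atom Du]mul1r; apply: kink_le.
apply: filterS near_xab => t tab; rewrite !mul1r Gx subrr subr_ge0.
exact: le_trans (ler_norm _) (G_le tab).
Qed.

Let contact_le_neg : - G x = alpha x -> - atom Du <= atom Ddalpha.
Proof.
move=> Gx; rewrite -mulN1r; apply: kink_le.
apply: filterS near_xab => t tab; rewrite !mulN1r Gx subrr subr_ge0.
by apply: le_trans (ler_norm _) _; rewrite normrN G_le.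
Qed.

(** As [alpha x > 0], contact with [alpha] excludes contact with [- alpha], hence the negative part
    has no atom at [x]. *)
Let contact_pos_variation : G x = alpha x ->
  charge_total_variation Du [set x] = (atom Du)%:E /\ 0 <= atom Du.
Proof.
move=> Gx; have n0 : neg [set x] = 0%E.
  by apply: neg_atom0; rewrite Gx; have := apos xab; lra.
rewrite charge_total_variationE -/pos -/neg Du_atom n0/= subr0 adde0.
by rewrite fineK ?fin_num_measure//; split=> //; rewrite fine_ge0.
Qed.

Let contact_neg_variation : - G x = alpha x ->
  charge_total_variation Du [set x] = (- atom Du)%:E /\ 0 <= - atom Du.
Proof.
move=> Gx; have p0 : pos [set x] = 0%E.
  by apply: pos_atom0; have := apos xab; move: Gx; lra.
rewrite charge_total_variationE -/pos -/neg Du_atom p0/= sub0r opprK add0e.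
by rewrite fineK ?fin_num_measure//; split=> //; rewrite fine_ge0.
Qed.

Let trichotomy y : y \in `]a, b[ ->
  [\/ G y = alpha y, - G y = alpha y | (G y < alpha y /\ - G y < alpha y)].
Proof.
move=> /G_le; rewrite ler_norml lerNl => /andP[].
rewrite !le_eqVlt => /predU1P[->|h1]; first by constructor 2.
by case/predU1P => [->|h2]; [constructor 1|constructor 3].
Qed.

(** Contact of either sign at [x] would bound a nonnegative jump by [Ddalpha {x}], which is
    negative. Hence [x] is off contact, and both parts of [Du] vanish near it. *)
Lemma concave_kink : (Ddalpha [set x] < 0)%E ->
  exists2 e : R, 0 < e & (`]x - e, x + e[ `<=` `]a, b[) /\
    charge_total_variation Du `]x - e, x + e[%classic = 0%E.
Proof.
rewrite atom_E lte_fin => D0; have [Gx|Gx|[Gx Gx']] := trichotomy xab.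
- have [_ h1] := contact_pos_variation Gx; have h2 := contact_le_pos Gx; exfalso; lra.
- have [_ h1] := contact_neg_variation Gx; have h2 := contact_le_neg Gx; exfalso; lra.
- exact: off_support.
Qed.

Lemma convex_kink_le : (0 < Ddalpha [set x])%E ->
  (charge_total_variation Du [set x] <= Ddalpha [set x])%E.
Proof.
rewrite atom_E lte_fin => D0; have [Gx|Gx|[Gx Gx']] := trichotomy xab.
- by rewrite (contact_pos_variation Gx).1 lee_fin contact_le_pos.
- by rewrite (contact_neg_variation Gx).1 lee_fin contact_le_neg.
- by rewrite charge_total_variationE -/pos -/neg pos_atom0// neg_atom0// adde0 lee_fin ltW.
Qed.

Let support_contact y : y \in `]a, b[ -> measure_support (charge_total_variation Du) y ->
  G y = alpha y \/ - G y = alpha y.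
Proof.
move=> yab sy; have [Gy|Gy|[Gy Gy']] := trichotomy yab; [by left|by right|].
have [e e0 [_ H]] := off_support yab Gy Gy'; exfalso.
pose J : set R := `]y - e, y + e[%classic.
have : (0 < charge_total_variation Du J)%E.
  apply: sy; first exact: itv_open.
  by rewrite /J/= in_itv/=; apply/andP; split; lra.
by rewrite /J H ltxx.
Qed.

(** Every point near [x] is in contact. The sign of contact cannot change there because [G] is
    continuous and nonzero at [x], so [alpha - s * G] is constantly 0 near [x] for a single [s]. *)
Lemma convex_kink_eq : (0 < Ddalpha [set x])%E ->
  (exists2 e : R, 0 < e & `]x - e, x + e[ `<=` measure_support (charge_total_variation Du)) ->
  charge_total_variation Du [set x] = Ddalpha [set x].
Proof.
move=> D0 [e e0 esupp].
have nsupp : \forall t \near x, measure_support (charge_total_variation Du) t.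
  have : \forall t \near x, t \in `]x - e, x + e[.
    by apply: near_in_itvoo; rewrite in_itv/= ltrBlDr ltrDl e0.
  by apply: filterS => t te; exact: esupp.
have xsupp := nbhs_singleton nsupp; have ax0 := apos xab.
case: (support_contact xab xsupp) => Gx.
- rewrite (contact_pos_variation Gx).1 atom_E -(@kink_eq 1) ?mul1r//.
  (* This rules out [- G t = alpha t] near [x], because [alpha t] is positive. *)
  have Gpos : \forall t \near x, 0 < G t by apply: (cvgr_gt (G x) (G_continuous xab)); rewrite Gx.
  near=> t; rewrite !mul1r Gx subrr.
  have tab : t \in `]a, b[ by near: t.
  have st : measure_support (charge_total_variation Du) t by near: t.
  have [->|E] := support_contact tab st; first by rewrite subrr.
  have Gt : 0 < G t by near: t.
  by have := apos tab; rewrite -E oppr_gt0 ltNge (ltW Gt).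
- rewrite (contact_neg_variation Gx).1 atom_E -(@kink_eq (-1)) ?mulN1r//.
  have Gneg : \forall t \near x, G t < 0.
    by apply: (cvgr_lt (G x) (G_continuous xab)); rewrite -oppr_gt0 Gx.
  near=> t; rewrite !mulN1r Gx subrr.
  have tab : t \in `]a, b[ by near: t.
  have st : measure_support (charge_total_variation Du) t by near: t.
  have [E|->] := support_contact tab st; last by rewrite subrr.
  have Gt : G t < 0 by near: t.
  by have := apos tab; rewrite -E ltNge (ltW Gt).
Unshelve. all: by end_near. Qed.

End necessary_conditions.

(** * A sufficient condition and the two examples *)

Section sufficient_condition.
Context {R : realType}.
Notation mu := (@lebesgue_measure R).
Implicit Types (a b c p q t r : R) (f u v w g : R -> R).
Implicit Types m n k : {finite_measure set (measurableTypeR R) -> \bar R}.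

(** Convexity: with [g = f - u], the square [(f - v) ^+ 2] is at least [g ^+ 2 - 2 * g * (v - u)].
    The integral of [g * v] is at most the weighted variation of [v], by duality with the bound on
    the tail integral, while that of [g * u] is at least the weighted variation of [u] by
    hypothesis. *)
Lemma tv_solution_sufficient a b f (alpha : R -> R) u
    (Df : {charge set (measurableTypeR R) -> \bar R}) m n :
  a < b -> BV_deriv a b f Df ->
  measurable_fun `]a, b[ alpha -> (exists K : R, forall t, `]a, b[%classic t -> `|alpha t| <= K) ->
  mu.-integrable `]a, b[ (EFin \o u) -> concentrated a b m -> concentrated a b n ->
  deriv_pair a b u m n ->
  (forall t, t \in `]a, b[ -> `|tail_integral b (fun s => f s - u s) t| <= alpha t) ->
  \int[mu]_(t in `]a, b[) (f t - u t) = 0 ->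
  \int[m]_(t in `]a, b[) alpha t + \int[n]_(t in `]a, b[) alpha t <=
    \int[mu]_(t in `]a, b[) ((f t - u t) * u t) ->
  tv_solution a b f alpha u (charge_diff m n).
Proof.
have arith (A B C D E X : R) : X - 2 * (A - B) <= C -> A <= D -> E <= B ->
    2^-1 * X + E <= 2^-1 * C + D.
  by move=> h1 h2 h3; lra.
move=> ab bf ma [K aK] iu cm cn dp Ga g0 Imn.
have bu := BV_deriv_charge_diff iu cm cn dp; split=> // v Dv bv.
pose g t := f t - u t.
have a0 t : `]a, b[%classic t -> 0 <= alpha t by move=> /Ga; exact: le_trans.
have i_f : mu.-integrable `]a, b[ (EFin \o f) by case: bf.
have iv : mu.-integrable `]a, b[ (EFin \o v) by case: bv.
have ig : mu.-integrable `]a, b[ (EFin \o g) by exact: integrable_sub.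
have ifv : mu.-integrable `]a, b[ (EFin \o (fun t => f t - v t)) by exact: integrable_sub.
have [Mf Hf] := BV_deriv_ae_bounded ab bf.
have [Mu Hu] := BV_deriv_ae_bounded ab bu.
have [Mv Hv] := BV_deriv_ae_bounded ab bv.
have aeB (w1 w2 : R -> R) (M1 M2 : R) : {ae mu, forall t, t \in `]a, b[ -> `|w1 t| <= M1} ->
    {ae mu, forall t, t \in `]a, b[ -> `|w2 t| <= M2} ->
    {ae mu, forall t, t \in `]a, b[ -> `|w1 t - w2 t| <= M1 + M2}.
  move=> H1 H2; apply: (@filterS2 _ _ (ae_filter_ringOfSetsType mu) _ _ _ _ H1 H2) => t h1 h2 tab.
  by rewrite (le_trans (ler_normB _ _))// lerD ?h1 ?h2.
have ig2 : mu.-integrable `]a, b[ (EFin \o (fun t => g t ^+ 2)).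
  exact: (square_integrable ig (aeB _ _ _ _ Hf Hu)).
have ifv2 : mu.-integrable `]a, b[ (EFin \o (fun t => (f t - v t) ^+ 2)).
  exact: (square_integrable ifv (aeB _ _ _ _ Hf Hv)).
have mfun w : mu.-integrable `]a, b[ (EFin \o w) -> measurable_fun `]a, b[ w.
  by move=> iw; apply/measurable_EFinP; exact: measurable_int iw.
(* The product is dominated by [g ^+ 2 + w ^+ 2]. *)
have igw w (M : R) : mu.-integrable `]a, b[ (EFin \o w) ->
    {ae mu, forall t, t \in `]a, b[ -> `|w t| <= M} ->
    mu.-integrable `]a, b[ (EFin \o (fun t => g t * w t)).
  move=> iw Hw; have iw2 := square_integrable iw Hw.
  apply: (le_integrable _ _ _ (integrable_add _ ig2 iw2)) => //.
    by apply/measurable_EFinP; apply: measurable_funM; exact: mfun.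
  move=> t _; rewrite lee_fin normrM.
  rewrite [leRHS]ger0_norm ?addr_ge0 ?sqr_ge0// -[g t ^+ 2]real_normK ?num_real//.
  rewrite -[w t ^+ 2]real_normK ?num_real//; have := sqr_ge0 (`|g t| - `|w t|).
  have := mulr_ge0 (normr_ge0 (g t)) (normr_ge0 (w t)); nra.
have igu := igw u Mu iu Hu.
have igv := igw v Mv iv Hv.
have Egv : \int[mu]_(t in `]a, b[) (g t * v t) <=
    \int[charge_pos_variation Dv]_(t in `]a, b[) alpha t +
    \int[charge_neg_variation Dv]_(t in `]a, b[) alpha t.
  have [c aev] := BV_deriv_ae ab bv.
  set p := charge_pos_variation Dv in aev *; set q := charge_neg_variation Dv in aev *.
  pose G := tail_integral b g.
  have igm k : mu.-integrable `]a, b[ (EFin \o (fun t => g t * mass k a t)).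
    have := @integrableMl _ _ _ mu `]a, b[ (measurable_itv _) _ (mass k a) ig.
    by apply=> //; [exact: measurable_mass|exact: bounded_mass].
  have igc : mu.-integrable `]a, b[ (EFin \o (fun t => c * g t)) by exact: integrable_scale.
  have imm : mu.-integrable `]a, b[ (EFin \o (fun t => g t * mass p a t - g t * mass q a t)).
    exact: integrable_sub.
  have -> : \int[mu]_(t in `]a, b[) (g t * v t) =
      \int[mu]_(t in `]a, b[) (c * g t + (g t * mass p a t - g t * mass q a t)).
    rewrite /Rintegral; congr fine; apply: ae_eq_integral => //.
    - exact: measurable_int igv.
    - by apply: (measurable_int mu); exact: integrable_add.
    - apply: (@filterS _ _ (ae_filter_ringOfSetsType mu) _ _ _ aev) => t h tab.
      by rewrite h//; congr (_%:E); ring.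
  (* The additive constant of [v] disappears because [g] has zero mean; the rest becomes integrals
     of the tail of [g] against the two parts of [Dv]. *)
  rewrite RintegralD// RintegralB// RintegralZl// g0 mulr0 add0r !(integral_mass _ ig).
  have mG : measurable_fun `]a, b[ G by exact: measurable_tail_integral.
  have GK t : `]a, b[%classic t -> `|G t| <= K.
    by move=> tab; rewrite (le_trans (Ga t tab))// (le_trans (ler_norm _))// aK.
  have iG k := bounded_fun_integrable k (measurable_itv _) mG GK.
  have ia k := bounded_fun_integrable k (measurable_itv _) ma aK.
  apply: lerD.
    apply: le_Rintegral => //; [exact: iG|exact: ia|].
    by move=> t tab; exact: le_trans (ler_norm _) (Ga t tab).
  rewrite -mulN1r -RintegralZl//; last exact: iG.
  apply: le_Rintegral => //; [|exact: ia|].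
    by apply: integrable_scale => //; exact: iG.
  move=> t tab; rewrite mulN1r; apply: le_trans (ler_norm _) _.
  by rewrite normrN; exact: Ga.
apply: (le_trans (tv_energy_charge_diff_le ma a0 aK m n ig2)).
rewrite (tv_energyE ma a0 aK _ ifv2) lee_fin.
have H : \int[mu]_(t in `]a, b[) g t ^+ 2 - 2 * (\int[mu]_(t in `]a, b[) (g t * v t) -
    \int[mu]_(t in `]a, b[) (g t * u t)) <= \int[mu]_(t in `]a, b[) (f t - v t) ^+ 2.
  rewrite -RintegralB// -RintegralZl//; last exact: integrable_sub.
  rewrite -RintegralB//; last by apply: integrable_scale => //; exact: integrable_sub.
  apply: le_Rintegral => //.
    by apply: integrable_sub => //; apply: integrable_scale => //; exact: integrable_sub.
  move=> t _; rewrite -subr_ge0 (_ : _ - _ = (v t - u t) ^+ 2) ?sqr_ge0//.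
  by rewrite /g; ring.
exact: (arith _ _ _ _ _ _ H Egv Imn).
Qed.

End sufficient_condition.

(** * Step functions and their derivatives *)

Section step_functions.
Context {R : realType}.
Notation mu := (@lebesgue_measure R).
Implicit Types (a b c p q t : R) (r : {nonneg R}).
Implicit Types m k : {finite_measure set (measurableTypeR R) -> \bar R}.

(** The zero measure written as a scaled Dirac mass, so that the integration rule for scaled
    measures covers it. *)
Definition null_measure : {finite_measure set (measurableTypeR R) -> \bar R} :=
  mscale (0 : R)%:nng (delta 0).

Lemma null_measureE (A : set R) : null_measure A = 0%E.
Proof. by rewrite -[LHS]/(0%:E * delta 0 A)%E mul0e. Qed.

Lemma null_measure_concentrated a b : concentrated a b null_measure.
Proof. by move=> A _ _; exact: null_measureE. Qed.

Lemma Rintegral_null_measure a b (g : R -> R) M : measurable_fun `]a, b[ g ->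
  (forall t, `]a, b[%classic t -> `|g t| <= M) ->
  \int[null_measure]_(t in `]a, b[) g t = 0.
Proof.
by move=> mg gM; rewrite (Rintegral_mscale (delta 0) _ (measurable_itv _) mg gM) mul0r.
Qed.

Lemma charge_diff_null_variation m (A : set R) : measurable A ->
  charge_total_variation (charge_diff m null_measure) A = m A.
Proof.
move=> mA; rewrite charge_total_variationE.
have n0 : charge_neg_variation (charge_diff m null_measure) A = 0%E.
  apply/eqP; rewrite eq_le measure_ge0 andbT -(null_measureE A).
  exact: charge_diff_neg_le.
rewrite n0 adde0; have := charge_decomp (charge_diff m null_measure) mA.
by rewrite n0 sube0 => <-; rewrite -[LHS]/(m A - null_measure A)%E null_measureE sube0.
Qed.

(** The jump is written as the distribution function of a Dirac mass, so its derivative follows from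
    [deriv_pair_add] applied to a constant. The value at [p] is the upper one. *)
Definition step a c r p t : R := c + r%:num * mass (delta p) a t.

Definition step_charge r p : {charge set (measurableTypeR R) -> \bar R} :=
  charge_diff (mscale r (delta p)) null_measure.

Lemma mass_delta a p t : a < p -> mass (delta p) a t = (p <= t)%R%:R.
Proof.
move=> ap; rewrite /mass deltaE indicE mem_setE in_itv/= ap.
by [].
Qed.

Lemma step_integrable a b c r p :
  mu.-integrable `]a, b[ (EFin \o (step a c r p)).
Proof.
apply: integrable_add => //.
  by apply: continuous_integrable_itv; exact: cst_continuous.
apply: integrable_scale => //; apply: measurable_bounded_integrable => //.
- exact: lebesgue_measure_itv_lty.
- exact: measurable_mass.
- exact: bounded_mass.
Qed.

Lemma step_charge_concentrated a b r p : p \in `]a, b[ -> concentrated a b (mscale r (delta p)).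
Proof. by move=> pab; apply: mscale_concentrated; exact: dirac_concentrated. Qed.

Lemma step_deriv_pair a b c r p : a < b ->
  deriv_pair a b (step a c r p) (mscale r (delta p)) null_measure.
Proof.
move=> ab.
have bnd phi : test_function a b phi -> exists M : R,
    measurable_fun `]a, b[ phi /\ forall t, `]a, b[%classic t -> `|phi t| <= M.
  move=> tphi; have [M phiM] := test_function_bounded tphi; exists M.
  by split=> //; exact: test_function_measurable tphi.
apply: (@deriv_pair_add _ a b (cst c) r%:num (delta p) null_measure null_measure).
- by apply: continuous_integrable_itv; exact: cst_continuous.
- move=> phi tphi; have [M [mphi phiM]] := bnd phi tphi.
  rewrite (Rintegral_null_measure mphi phiM) subrr oppr0.
  rewrite RintegralZl//; last exact: test_function_derive1_integrable tphi.
  have dphi t : is_derive t 1 phi (derive1 phi t).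
    by apply: derivable_is_derive; exact: test_function_derivable tphi t.
  rewrite (Rintegral_derive false true (ltW ab) dphi); last first.
    exact: test_function_derive1_continuous tphi.
  by rewrite !(test_function_out tphi) ?subrr ?mulr0// in_itv/= ltxx ?andbF.
- move=> phi tphi; have [M [mphi phiM]] := bnd phi tphi.
  rewrite (Rintegral_null_measure mphi phiM) !subr0 add0r.
  by rewrite (Rintegral_mscale (delta p) r (measurable_itv _) mphi phiM).
Qed.

Lemma step_BV a b c r p : p \in `]a, b[ ->
  BV_deriv a b (step a c r p) (step_charge r p).
Proof.
move=> pab; apply: BV_deriv_charge_diff.
- exact: step_integrable.
- exact: step_charge_concentrated.
- exact: null_measure_concentrated.
- apply: step_deriv_pair; move: pab; rewrite in_itv/= => /andP[]; exact: lt_trans.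
Qed.

Lemma delta_set1 p q : delta p [set q] = ((p == q)%:R : R)%:E.
Proof.
by rewrite deltaE indicE (_ : (p \in [set q]) = (p == q))//; apply/idP/eqP; rewrite inE.
Qed.

Lemma step_charge_set1 r p q : step_charge r p [set q] = (r%:num * (p == q)%:R)%:E.
Proof.
rewrite -[LHS]/(r%:num%:E * delta p [set q] - null_measure [set q])%E.
by rewrite null_measureE sube0 delta_set1 EFinM.
Qed.

Lemma step_charge_variation_set1 r p q :
  charge_total_variation (step_charge r p) [set q] = (r%:num * (p == q)%:R)%:E.
Proof.
rewrite charge_diff_null_variation// -[LHS]/(r%:num%:E * delta p [set q])%E.
by rewrite delta_set1 EFinM.
Qed.

Lemma Rintegral_cst_itv p q c (bl br : bool) : p <= q ->
  \int[mu]_(t in [set` Interval (BSide bl p) (BSide br q)]) c = c * (q - p).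
Proof.
move=> pq; have d t : is_derive t (1 : R) (fun t => c * t + 0) (cst c t).
  exact: is_derive_affine.
rewrite (Rintegral_derive bl br pq d); last exact: cst_continuous.
by rewrite !addr0 mulrBr.
Qed.

Lemma tail_integral_step a b c r p q : a < p -> a < q -> q < b -> p < b ->
  tail_integral b (step a c r p) q = c * (b - q) + r%:num * (b - Num.max p q).
Proof.
move=> ap aq qb pb; have ab := lt_trans ap pb.
have sub : `[q, b[ `<=` `]a, b[.
  by move=> t /=; rewrite !in_itv/= => /andP[qt ->]; rewrite (lt_le_trans aq qt).
have im : mu.-integrable `[q, b[ (EFin \o mass (delta p) a).
  apply: measurable_bounded_integrable => //.
  - exact: lebesgue_measure_itv_lty.
  - exact: measurable_mass.
  - exact: bounded_mass.
rewrite /tail_integral /step RintegralD//; last exact: integrable_scale.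
- rewrite Rintegral_cst_itv ?ltW// RintegralZl//; congr (_ + _ * _).
  transitivity (\int[mu]_(t in `[Num.max p q, b[) 1).
    rewrite Rintegral_mkcond [RHS]Rintegral_mkcond; apply: eq_Rintegral => t _.
    rewrite !patchE mass_delta// !mem_setE !in_itv/= ge_max.
    by case: (p <= t); case: (q <= t); case: (t < b).
  by rewrite Rintegral_cst_itv ?mul1r// ge_max !ltW.
- by apply: continuous_integrable_itv; exact: cst_continuous.
Qed.

End step_functions.

(** * Hinge weights and explicit solutions *)

Section examples.
Context {R : realType}.
Notation mu := (@lebesgue_measure R).
Implicit Types (p q s t : R).

(** The weight of both examples: for [s >= 0] it is at least 1, and its slope jumps by [s] at
    [x]. *)
Definition hinge (x s t : R) : R := 1 + s * Num.max (t - x) 0.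

Lemma hinge_continuous x s : continuous (hinge x s).
Proof.
move=> t; rewrite /hinge; apply: cvgD; first exact: cvg_cst.
apply: cvgMr; apply: (@continuous_max _ _ (fun t => t - x) (cst 0) t); last exact: cst_continuous.
by apply: cvgB; [exact: cvg_id|exact: cvg_cst].
Qed.

Variables (a b x : R).
Hypothesis xab : x \in `]a, b[.

Let ax : a < x. Proof. by move: xab; rewrite in_itv/= => /andP[]. Qed.
Let xb : x < b. Proof. by move: xab; rewrite in_itv/= => /andP[]. Qed.
Let ab : a < b. Proof. exact: lt_trans ax xb. Qed.

(** With [H] the unit step at [x], the product of the hinge and [derive1 phi] equals
    [derive1 phi + r * H * dU - r * H * phi], where [dU] is the derivative of [(t - x) * phi t]. The
    first two terms integrate to 0, since [phi] vanishes at [a] and [b] and [(t - x) * phi t] at [x]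
    and [b]. *)
Lemma hinge_weak_derivative (r : {nonneg R}) :
  weak_derivative a b (hinge x r%:num) (step a 0 r x).
Proof.
move=> phi tphi.
pose dphi : R -> R := derive1 phi.
have dphiE t : is_derive t (1 : R) phi (dphi t).
  by apply: derivable_is_derive; exact: test_function_derivable tphi t.
have cphi : continuous phi := test_function_continuous tphi.
have cdphi : continuous dphi := test_function_derive1_continuous tphi.
pose dU t : R := (t - x) * dphi t + phi t.
have dUE t : is_derive t (1 : R) (fun t => (t - x) * phi t) (dU t).
  have dx : is_derive t (1 : R) (fun t => 1 * t + - x) 1 by exact: is_derive_affine.
  have := is_deriveM dx (dphiE t).
  rewrite (_ : _ * _ = (fun t => (t - x) * phi t)); last by apply/funext => s; rewrite fctE mul1r.
  move=> D; apply: (is_derive_eq D).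
  by rewrite /dU/= mul1r [X in _ + X](_ : _ = phi t)// -[LHS]/(phi t * 1) mulr1.
have cdU : continuous dU.
  move=> t; apply: cvgD; last exact: cphi.
  by apply: cvgM; [apply: cvgB; [exact: cvg_id|exact: cvg_cst]|exact: cdphi].
have phib : phi b = 0 by rewrite (test_function_out tphi)// in_itv/= ltxx andbF.
have phia : phi a = 0 by rewrite (test_function_out tphi)// in_itv/= ltxx.
have i1 : \int[mu]_(t in `]a, b[) dphi t = 0.
  by rewrite (Rintegral_derive false true (ltW ab) dphiE cdphi) phib phia subrr.
have i2 : \int[mu]_(t in `]a, b[) (mass (delta x) a t * dU t) = 0.
  transitivity (\int[mu]_(t in `[x, b[) dU t); last first.
    by rewrite (Rintegral_derive true true (ltW xb) dUE cdU) phib subrr mulr0 mul0r subrr.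
  rewrite Rintegral_mkcond [RHS]Rintegral_mkcond; apply: eq_Rintegral => t _.
  rewrite !patchE mass_delta// !mem_setE !in_itv/=.
  have [xt|tx] := leP x t; last by rewrite mul0r; case: ifP.
  by rewrite (lt_le_trans ax xt) mul1r.
have imdU : mu.-integrable `]a, b[ (EFin \o (fun t => mass (delta x) a t * dU t)).
  have := @integrableMr _ _ _ mu `]a, b[ (measurable_itv _) (mass (delta x) a) (EFin \o dU).
  apply=> //; [exact: measurable_mass|exact: bounded_mass|].
  exact: continuous_integrable_itv.
have istep : mu.-integrable `]a, b[ (EFin \o (fun t => step a 0 r x t * phi t)).
  have [M phiM] := test_function_bounded tphi.
  have := @integrableMl _ _ _ mu `]a, b[ (measurable_itv _) _ phi (step_integrable a b 0 r x).
  apply=> //; first exact: test_function_measurable tphi.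
  by exists M; split; [exact: num_real|move=> N /ltW MN t _ /=; exact: le_trans (phiM t) MN].
have E t : hinge x r%:num t * dphi t =
    dphi t + r%:num * (mass (delta x) a t * dU t) - step a 0 r x t * phi t.
  rewrite /hinge /step /dU mass_delta//; have [xt|tx] := leP x t.
    by rewrite max_l ?subr_ge0//=; ring.
  by rewrite max_r ?subr_le0 ?ltW//=; ring.
have idphi : mu.-integrable `]a, b[ (EFin \o dphi) by exact: continuous_integrable_itv.
have irm : mu.-integrable `]a, b[ (EFin \o (fun t => r%:num * (mass (delta x) a t * dU t))).
  exact: integrable_scale.
rewrite (_ : \int[mu]_(t in `]a, b[) (hinge x r%:num t * derive1 phi t) =
  \int[mu]_(t in `]a, b[) (dphi t + r%:num * (mass (delta x) a t * dU t) -
    step a 0 r x t * phi t)); last first.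
  by apply: eq_Rintegral => t _; rewrite -E.
rewrite RintegralB//; last exact: integrable_add.
by rewrite RintegralD// RintegralZl// i1 i2 mulr0 addr0 sub0r.
Qed.

Lemma hinge_data (f : R -> R) (Df : {charge set (measurableTypeR R) -> \bar R}) (r : {nonneg R}) :
  0 < r%:num -> BV_deriv a b f Df -> charge_total_variation Df [set x] = 0%E ->
  tv_data a b x f Df (hinge x r%:num) (step a 0 r x) (step_charge r x).
Proof.
move=> r0 bf Df0; split=> //.
- by apply: continuous_subspaceT; exact: hinge_continuous.
- by move=> t _; rewrite /hinge ltr_wpDr// mulr_ge0// le_max lexx orbT.
- by split; [exact: hinge_weak_derivative|exact: step_BV].
- by rewrite step_charge_variation_set1 eqxx mulr1 lte_fin.
Qed.

Lemma hinge_bounded r : measurable_fun `]a, b[ (hinge x r) /\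
  exists K : R, forall t, `]a, b[%classic t -> `|hinge x r t| <= K.
Proof.
split; first by apply: measurable_funTS; apply: continuous_measurable_fun; exact: hinge_continuous.
have [K HK] := @continuous_bounded_itv _ (hinge x r) a b
  (continuous_subspaceT (@hinge_continuous x r)).
by exists K => t /=; rewrite in_itv/= => /andP[at_ tb]; rewrite HK// !ltW.
Qed.

Lemma Rintegral_step_oo c (r : {nonneg R}) p : a < p -> p < b ->
  \int[mu]_(t in `]a, b[) step a c r p t = c * (b - a) + r%:num * (b - p).
Proof.
move=> ap pb.
have im : mu.-integrable `]a, b[ (EFin \o mass (delta p) a).
  apply: measurable_bounded_integrable => //.
  - exact: lebesgue_measure_itv_lty.
  - exact: measurable_mass.
  - exact: bounded_mass.
rewrite /step RintegralD//; last exact: integrable_scale.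
  rewrite Rintegral_cst_itv ?ltW// RintegralZl//; congr (_ + _ * _).
  transitivity (\int[mu]_(t in `[p, b[) (1 : R)); last by rewrite Rintegral_cst_itv ?mul1r// ltW.
  rewrite Rintegral_mkcond [RHS]Rintegral_mkcond; apply: eq_Rintegral => t _.
  rewrite !patchE mass_delta// !mem_setE !in_itv/=.
  have [pt|tp] := leP p t; last by case: ifP.
  by rewrite (lt_le_trans ap pt).
by apply: continuous_integrable_itv; exact: cst_continuous.
Qed.

(** For a single step of height [r], the weighted variation is [r * hinge x s x] and the integral of
    [(f - u) * u] is [r] times the tail integral at [x]. Keeping the factor [r] in the last
    hypothesis covers [r = 0], where no contact at [x] is needed. *)
Lemma hinge_solution (f : R -> R) (Df : {charge set (measurableTypeR R) -> \bar R})
    (s : R) (r : {nonneg R}) :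
  BV_deriv a b f Df ->
  (forall t, t \in `]a, b[ ->
    `|tail_integral b (fun p => f p - step a 0 r x p) t| <= hinge x s t) ->
  \int[mu]_(t in `]a, b[) (f t - step a 0 r x t) = 0 ->
  r%:num * hinge x s x <= r%:num * tail_integral b (fun p => f p - step a 0 r x p) x ->
  tv_solution a b f (hinge x s) (step a 0 r x) (step_charge r x).
Proof.
move=> bf Gs g0 Gx; have [mh [K hK]] := hinge_bounded s.
have iu := step_integrable a b 0 r x.
have ig : mu.-integrable `]a, b[ (EFin \o (fun t => f t - step a 0 r x t)).
  by apply: integrable_sub => //; case: bf.
apply: (tv_solution_sufficient ab bf mh _ iu _ _ (step_deriv_pair _ _ _ ab) Gs g0).
- by exists K.
- exact: step_charge_concentrated.
- exact: null_measure_concentrated.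
rewrite (Rintegral_null_measure mh hK) addr0.
rewrite (Rintegral_mscale (delta x) r (measurable_itv _) mh hK) Rintegral_dirac//.
apply: (le_trans Gx); rewrite le_eqVlt; apply/orP; left; apply/eqP.
transitivity (r%:num * \int[mu]_(t in `]a, b[) ((f t - step a 0 r x t) * mass (delta x) a t)).
  by rewrite integral_mass// Rintegral_dirac//; exact: measurable_tail_integral.
rewrite -RintegralZl//.
  by apply: eq_Rintegral => t _; rewrite mulrCA; congr (_ * _); rewrite /step add0r.
have := @integrableMl _ _ _ mu `]a, b[ (measurable_itv _) _ (mass (delta x) a) ig.
by apply=> //; [exact: measurable_mass|exact: bounded_mass].
Qed.

(** Here [f = u = 0], written as steps of height 0 so that the lemmas on steps apply; the residual
    vanishes, and the hinge of slope 1 supplies the kink. *)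
Lemma no_jump_example : exists (f : R -> R) (Df : {charge set (measurableTypeR R) -> \bar R})
    (alpha dalpha : R -> R) (Ddalpha : {charge set (measurableTypeR R) -> \bar R})
    (u : R -> R) (Du : {charge set (measurableTypeR R) -> \bar R}),
  [/\ tv_data a b x f Df alpha dalpha Ddalpha, tv_solution a b f alpha u Du,
      (0 < Ddalpha [set x])%E & charge_total_variation Du [set x] = 0%E].
Proof.
pose o : {nonneg R} := NngNum (lexx (0 : R)); pose i : {nonneg R} := NngNum (@ler01 R).
exists (step a 0 o x), (step_charge o x), (hinge x i%:num), (step a 0 i x), (step_charge i x).
exists (step a 0 o x), (step_charge o x).
have o0 : charge_total_variation (step_charge o x) [set x] = 0%E.
  by rewrite step_charge_variation_set1 mul0r.
have G0 t : tail_integral b (fun p => step a 0 o x p - step a 0 o x p) t = 0.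
  by rewrite /tail_integral; under eq_Rintegral do rewrite subrr; rewrite /Rintegral integral0.
split=> //.
- by apply: hinge_data => //; exact: step_BV.
- apply: hinge_solution; first exact: step_BV.
  + move=> t _; rewrite G0 normr0 /hinge addr_ge0// mulr_ge0// le_max lexx orbT//.
  + by under eq_Rintegral do rewrite subrr; rewrite /Rintegral integral0.
  + by rewrite !mul0r.
- by rewrite step_charge_set1 eqxx mulr1 lte_fin.
Qed.

(* [alpha] is a hinge of slope [s = 1 + 1 / L], [u] the unit step at [x] and [f] a step
   at [y] of height [beta = 2 s + 1 / h], where [L = x - a], [h = (b - x) / 2] and
   [y = x + h]. The integral [G p] of [f - u] over [p, b] then increases linearly from [0]
   to [alpha x = 1] on [a, x], equals [alpha p = 1 + s (p - x)] on [x, y], and decreases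
   linearly to [0] on [y, b]. *)
Lemma jump_example : exists (f : R -> R) (Df : {charge set (measurableTypeR R) -> \bar R})
    (alpha dalpha : R -> R) (Ddalpha : {charge set (measurableTypeR R) -> \bar R})
    (u : R -> R) (Du : {charge set (measurableTypeR R) -> \bar R}),
  [/\ tv_data a b x f Df alpha dalpha Ddalpha, tv_solution a b f alpha u Du,
      (0 < Ddalpha [set x])%E & (0 < charge_total_variation Du [set x])%E].
Proof.
pose L := x - a; pose h := (b - x) / 2; pose i := L^-1; pose j := h^-1.
have L0 : 0 < L by rewrite subr_gt0.
have h0 : 0 < h by rewrite divr_gt0// subr_gt0.
have i0 : 0 < i by rewrite invr_gt0.
have j0 : 0 < j by rewrite invr_gt0.
have iL : i * L = 1 by rewrite mulVf ?gt_eqF.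
have jh : j * h = 1 by rewrite mulVf ?gt_eqF.
have bE : b = x + 2 * h by rewrite /h; field.
have aE : a = x - L by rewrite /L opprB addrC subrK.
have [y yE] : exists y, y = x + h by exists (x + h).
clearbody L h i j.
have xy : x < y by rewrite yE ltrDl.
have yb : y < b by rewrite bE yE; lra.
have ay : a < y := lt_trans ax xy.
have s0 : 0 < 1 + i by rewrite addr_gt0.
have beta0 : 0 < 2 * (1 + i) + j by rewrite addr_gt0// mulr_gt0.
pose one : {nonneg R} := NngNum (@ler01 R).
pose s : {nonneg R} := NngNum (ltW s0).
pose beta : {nonneg R} := NngNum (ltW beta0).
have yab : y \in `]a, b[ by rewrite in_itv/= ay yb.
have bf : BV_deriv a b (step a (- i) beta y) (step_charge beta y) by exact: step_BV.
have GE p : p \in `]a, b[ -> tail_integral b (fun p => step a (- i) beta y p - step a 0 one x p) p =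
    - i * (b - p) + (2 * (1 + i) + j) * (b - Num.max y p) - (b - Num.max x p).
  rewrite in_itv/= => /andP[ap pb].
  have sub : `[p, b[ `<=` `]a, b[.
    by move=> t /=; rewrite !in_itv/= => /andP[pt ->]; rewrite (lt_le_trans ap pt).
  have istep c r q : mu.-integrable `[p, b[ (EFin \o step a c r q).
    by apply: integrableS (step_integrable a b c r q).
  rewrite /tail_integral RintegralB//; [|exact: istep..].
  rewrite -[X in X - _]/(tail_integral b (step a (- i) beta y) p).
  rewrite -[X in _ - X]/(tail_integral b (step a 0 one x) p).
  by rewrite !tail_integral_step//= mul0r add0r mul1r.
(* The base value [- 1 / L] of [f] makes [G] gain exactly 1 on [[a, x]]. On [[y, b]] the residual is
   [s + 1 / h], whose integral [s * h + 1] over length [h] is [alpha y]; this determines [beta]. *)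
exists (step a (- i) beta y), (step_charge beta y).
exists (hinge x s%:num), (step a 0 s x), (step_charge s x).
exists (step a 0 one x), (step_charge one x).
split.
- apply: hinge_data => //.
  by rewrite step_charge_variation_set1 gt_eqF// mulr0.
- apply: (hinge_solution bf).
  + move=> p pab; rewrite GE//; move: pab; rewrite in_itv/= => /andP[ap pb].
    rewrite /hinge /=.
    have [px|xp] := leP p x.
      have py := le_trans px (ltW xy).
      rewrite (max_l py) (_ : Num.max (p - x) 0 = 0); last first.
        by rewrite max_r// subr_le0.
      rewrite mulr0 addr0.
      rewrite (_ : _ - _ = 1 - i * (x - p)); last by rewrite bE yE; ring: jh.
      have xp0 : 0 <= x - p by rewrite subr_ge0.
      have id0 := mulr_ge0 (ltW i0) xp0.
      have id1 : i * (x - p) <= 1 by rewrite -iL ler_pM2l// aE in ap *; lra.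
      by rewrite ger0_norm; lra.
    have xp0 : 0 < p - x by rewrite subr_gt0.
    rewrite (max_l (ltW xp0)).
    have [py|yp] := leP p y.
      rewrite (_ : _ - _ = 1 + (1 + i) * (p - x)); last by rewrite bE yE; ring: jh.
      by rewrite ger0_norm// addr_ge0// mulr_ge0// ltW.
    have bp0 : 0 < b - p by rewrite subr_gt0.
    (* Beyond [y], [G p] is at most [(s + 1 / h) * h = 1 + s * h], the value of [alpha] at [y], and
       [alpha] is increasing there. *)
    rewrite (_ : _ - _ = ((1 + i) + j) * (b - p)); last by ring.
    rewrite ger0_norm; last by rewrite mulr_ge0 ?(ltW bp0)// addr_ge0 ?ltW.
    apply: (@le_trans _ _ (((1 + i) + j) * h)).
      by rewrite ler_pM2l ?addr_gt0//; lra.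
    rewrite mulrDl jh addrC lerD2l ler_pM2l//; lra.
  + have istep c r q : mu.-integrable `]a, b[ (EFin \o step a c r q) by exact: step_integrable.
    rewrite RintegralB//; [|exact: istep..].
    rewrite !Rintegral_step_oo//= mul0r add0r mul1r.
    by rewrite aE bE yE; ring: jh iL.
  (* Contact at the jump: both sides equal 1. *)
  + rewrite /= !mul1r GE// /hinge subrr !maxxx mulr0 addr0 max_l ?(ltW xy)//.
    by rewrite le_eqVlt; apply/orP; left; apply/eqP; rewrite bE yE; ring: jh.
- by rewrite step_charge_set1 eqxx mulr1 lte_fin.
- by rewrite step_charge_variation_set1 eqxx mulr1 lte_fin ltr01.
Qed.

End examples.

Theorem proposition3p7 (R : realType) (a b x : R) (hx : x \in `]a, b[) :
  (forall (f : R -> R) (Df : {charge set (measurableTypeR R) -> \bar R})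
      (alpha dalpha : R -> R)
      (Ddalpha : {charge set (measurableTypeR R) -> \bar R})
      (u : R -> R) (Du : {charge set (measurableTypeR R) -> \bar R}),
    tv_data a b x f Df alpha dalpha Ddalpha ->
    tv_solution a b f alpha u Du ->
    ((Ddalpha [set x] < 0)%E ->
      exists2 e : R, 0 < e &
        (`]x - e, x + e[ `<=` `]a, b[) /\
        charge_total_variation Du `]x - e, x + e[%classic = 0%E) /\
    ((0 < Ddalpha [set x])%E ->
      (charge_total_variation Du [set x] <= Ddalpha [set x])%E /\
      ((exists2 e : R, 0 < e &
          `]x - e, x + e[ `<=` measure_support (charge_total_variation Du)) ->
        (0 < charge_total_variation Du [set x])%E /\
        charge_total_variation Du [set x] = Ddalpha [set x]))) /\
  (exists (f : R -> R) (Df : {charge set (measurableTypeR R) -> \bar R})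
      (alpha dalpha : R -> R)
      (Ddalpha : {charge set (measurableTypeR R) -> \bar R})
      (u : R -> R) (Du : {charge set (measurableTypeR R) -> \bar R}),
    [/\ tv_data a b x f Df alpha dalpha Ddalpha,
        tv_solution a b f alpha u Du,
        (0 < Ddalpha [set x])%E &
        (0 < charge_total_variation Du [set x])%E]) /\
  (exists (f : R -> R) (Df : {charge set (measurableTypeR R) -> \bar R})
      (alpha dalpha : R -> R)
      (Ddalpha : {charge set (measurableTypeR R) -> \bar R})
      (u : R -> R) (Du : {charge set (measurableTypeR R) -> \bar R}),
    [/\ tv_data a b x f Df alpha dalpha Ddalpha,
        tv_solution a b f alpha u Du,
        (0 < Ddalpha [set x])%E &
        charge_total_variation Du [set x] = 0%E]).
Proof.
split; last by split; [exact: jump_example|exact: no_jump_example].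
move=> f Df alpha dalpha Ddalpha u Du data solu; split=> [D0|D0].
  exact: concave_kink hx data solu D0.
split; first exact: convex_kink_le hx data solu D0.
move=> supp; have E := convex_kink_eq hx data solu D0 supp.
by split=> //; rewrite E.
Qed.
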